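(* Let $R$ be a commutative $\mathbb{Q}$-algebra and let $f(u)\in R[[u]]$ be a formal power series with $f(0)=0$ and $f'(0)=1$. Then the following are equivalent. (0) $f$ has an addition theorem of the form $$f(u+v)=\frac{f(u)^2\xi_1(v)-f(v)^2\xi_1(u)}{f(u)\xi_2(v)-f(v)\xi_2(u)}$$ for some series $\xi_1,\xi_2\in R[[u]]$ with $\xi_1(0)=\xi_2(0)=1$. (i) For some $p_1,p_2,p_3,p_4\in R$, $f$ is the inversion (compositional inverse) of $u=\int_0^x\frac{dt}{\mathcal{B}(t)}$, or equivalently $f$ is a solution of $f'=\mathcal{B}(f)$. (ii) For some $p_1,p_2,p_3,p_4\in R$, the series $h(x):=\frac{f'(x)}{f(x)}$ satisfies the differential equation $$(h'(x))^2=S(h(x)),\qquad S(t)=p_4+p_3t+p_2t^2+p_1t^3+t^4.$$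
   Context: Given $p_1,p_2,p_3,p_4$ in a commutative $\mathbb{Q}$-algebra $R$, put $\mathcal{R}(x)=\sqrt{1+p_1x+p_2x^2+p_3x^3+p_4x^4}$ (the square root with constant term $1$). The series $\mathcal{B}(x)\in R[[x]]$ (depending on $p_1,\dots,p_4$) is the unique formal power series with $\mathcal{B}(0)=1$ such that, with $\mu(x):=x/\mathcal{B}(x)$, one has $\mathcal{B}(x)=\mathcal{R}(\mu(x))/\mu'(x)$. Here $h=f'/f$ is a formal Laurent series in $R((x))$. *)

(* Defs.v *)
From HB Require Import structures.
From mathcomp Require Import all_boot all_order all_algebra.
From mathcomp Require Import zify ring.
From mathcomp Require Import all_classical.

Set Implicit Arguments.
Unset Strict Implicit.
Unset Printing Implicit Defensive.

Import Order.TTheory GRing.Theory Num.Theory.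
Local Open Scope ring_scope.

(* A commutative Q-algebra is a commutative ring R, possibly trivial, together
   with a ring morphism from rat to R: MathComp's [comAlgType rat] would exclude
   the zero ring. *)

Record fps (R : Type) := Fps { fps_coef :> nat -> R }.

Section FpsRing.
Variable R : comPzRingType.
Implicit Types f g h : fps R.

HB.instance Definition _ := gen_eqMixin (fps R).
HB.instance Definition _ := gen_choiceMixin (fps R).

Lemma fpsP f g : (forall n, f n = g n) <-> f = g.
Proof.
split=> [|-> //]; case: f g => [f] [g] /= fg.
by congr Fps; apply: funext.
Qed.

Definition fps_zero : fps R := Fps (fun=> 0).
Definition fps_opp f : fps R := Fps (fun n => - f n).
Definition fps_add f g : fps R := Fps (fun n => f n + g n).

Fact fps_addA : associative fps_add.
Proof. by move=> f g h; apply/fpsP => n /=; rewrite addrA. Qed.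
Fact fps_addC : commutative fps_add.
Proof. by move=> f g; apply/fpsP => n /=; rewrite addrC. Qed.
Fact fps_add0 : left_id fps_zero fps_add.
Proof. by move=> f; apply/fpsP => n /=; rewrite add0r. Qed.
Fact fps_addN : left_inverse fps_zero fps_opp fps_add.
Proof. by move=> f; apply/fpsP => n /=; rewrite addNr. Qed.

HB.instance Definition _ :=
  GRing.isZmodule.Build (fps R) fps_addA fps_addC fps_add0 fps_addN.

Definition fpsC (c : R) : fps R := Fps (fun n => if n is 0%N then c else 0).
Definition fps_mul f g : fps R :=
  Fps (fun n => \sum_(i < n.+1) f i * g (n - i)%N).

Fact fps_mulC : commutative fps_mul.
Proof.
move=> f g; apply/fpsP => n /=; rewrite (reindex_inj rev_ord_inj) /=.
by apply: eq_bigr => i _; rewrite subSS mulrC subKn// -ltnS.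
Qed.

Fact fps_mulA : associative fps_mul.
Proof.
have rev f g n : fps_mul f g n = \sum_(i < n.+1) f (n - i)%N * g i.
  rewrite fps_mulC /=; by apply: eq_bigr => i _; rewrite mulrC.
move=> p q r; apply/fpsP => i; rewrite [RHS]rev.
pose coef3 j k := p j * (q (i - j - k)%N * r k).
transitivity (\sum_(j < i.+1) \sum_(k < i.+1 | (k <= i - j)%N) coef3 j k).
  apply: eq_bigr => j _; rewrite rev big_distrr /=.
  by rewrite (big_ord_narrow_leq (leq_subr _ _)).
rewrite (exchange_big_dep predT) //=; apply: eq_bigr => k _.
transitivity (\sum_(j < i.+1 | (j <= i - k)%N) coef3 j k).
  apply: eq_bigl => j; rewrite -ltnS -(ltnS j) -!subSn ?leq_ord //.
  by rewrite -subn_gt0 -(subn_gt0 j) -!subnDA addnC.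
rewrite (big_ord_narrow_leq (leq_subr _ _)) big_distrl /=.
by apply: eq_bigr => j _; rewrite /coef3 -!subnDA addnC mulrA.
Qed.

Fact fps_mul1 : left_id (fpsC 1) fps_mul.
Proof.
move=> f; apply/fpsP => n /=; rewrite big_ord_recl /= mul1r subn0.
by rewrite big1 ?addr0 // => i _; rewrite mul0r.
Qed.

Fact fps_mulDl : left_distributive fps_mul fps_add.
Proof.
move=> f g h; apply/fpsP => n /=; rewrite -big_split /=.
by apply: eq_bigr => i _; rewrite mulrDl.
Qed.

HB.instance Definition _ :=
  GRing.Zmodule_isComPzRing.Build (fps R) fps_mulA fps_mulC fps_mul1 fps_mulDl.

Lemma coef_fps0 n : (0 : fps R) n = 0. Proof. by []. Qed.
Lemma coef_fpsN f n : (- f) n = - f n. Proof. by []. Qed.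
Lemma coef_fpsD f g n : (f + g) n = f n + g n. Proof. by []. Qed.
Lemma coef_fpsB f g n : (f - g) n = f n - g n. Proof. by []. Qed.
Lemma coef_fps1 n : (1 : fps R) n = (n == 0)%:R. Proof. by case: n. Qed.
Lemma coef_fpsM f g n : (f * g) n = \sum_(i < n.+1) f i * g (n - i)%N.
Proof. by []. Qed.
Lemma coef_fpsM0 f g : (f * g) 0%N = f 0%N * g 0%N.
Proof. by rewrite coef_fpsM big_ord1. Qed.

End FpsRing.

Definition fpsX (R : comPzRingType) : fps R := Fps (fun n => (n == 1)%:R).

Definition fps_deriv (R : comPzRingType) (f : fps R) : fps R :=
  Fps (fun n => f n.+1 *+ n.+1).

Lemma coef_fps_deriv (R : comPzRingType) (f : fps R) n :
  fps_deriv f n = f n.+1 *+ n.+1.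
Proof. by []. Qed.

(* The primitive with constant term 0; division by n.+1 uses the structure
   morphism of the Q-algebra. *)
Definition fps_int (R : comPzRingType) (iota : {rmorphism rat -> R})
    (f : fps R) : fps R :=
  Fps (fun n => if n is k.+1 then iota (n%:R^-1) * f k else 0).

(* f(g(x)), for g without constant term: the terms f_k g^k with k > n do not
   contribute to the coefficient of x^n. *)
Definition fps_comp (R : comPzRingType) (f g : fps R) : fps R :=
  Fps (fun n => \sum_(k < n.+1) f k * (g ^+ k) n).

(* Elements of R[[u, v]] are encoded as series in v with coefficients in
   R[[u]], so that [F j i] is the coefficient of u^i v^j in F. *)
Definition varu (R : comPzRingType) : fps (fps R) := fpsC (fpsX R).
Definition varv (R : comPzRingType) : fps (fps R) := fpsX (fps R).

(* f(G(u, v)), for G in R[[u, v]] without constant term. *)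
Definition fps_comp2 (R : comPzRingType) (f : fps R) (G : fps (fps R)) :
    fps (fps R) :=
  Fps (fun j => Fps (fun i => \sum_(k < (i + j).+1) f k * (G ^+ k) j i)).

(* The ring inverse, with default value 0 for non-invertible elements. *)
Definition rinv (A : comPzRingType) (a : A) : A :=
  xget 0 [set b | a * b = 1]%classic.

(* q is the value of the fraction a / b in the total ring of fractions of A,
   which requires b to be a non-zero-divisor. *)
Definition is_quotient (A : comPzRingType) (q a b : A) : Prop :=
  GRing.lreg b /\ q * b = a.

Lemma rinvE (A : comPzRingType) (a b : A) : a * b = 1 -> rinv a = b.
Proof.
move=> ab; apply: xget_unique => // c /= ac.
by rewrite -[c]mul1r -ab mulrAC ac mul1r.
Qed.

Section FixedPoint.
Variable R : comPzRingType.
Implicit Types f g h s t : fps R.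

Definition agree n s t := forall i, (i < n)%N -> s i = t i.

Lemma agreeW n s t : agree n.+1 s t -> agree n s t.
Proof. by move=> st i /ltnW; apply: st. Qed.

Lemma agreeD n f g s t : agree n f g -> agree n s t -> agree n (f + s) (g + t).
Proof. by move=> fg st i lt_in; rewrite !coef_fpsD fg // st. Qed.

Lemma agreeN n s t : agree n s t -> agree n (- s) (- t).
Proof. by move=> st i lt_in; rewrite !coef_fpsN st. Qed.

Lemma agreeM n f g s t : agree n f g -> agree n s t -> agree n (f * s) (g * t).
Proof.
move=> fg st i lt_in; rewrite !coef_fpsM; apply: eq_bigr => j _.
by rewrite fg ?st //; [apply: leq_ltn_trans lt_in; apply: leq_subr
  | apply: leq_ltn_trans lt_in; rewrite -ltnS].
Qed.

Lemma agreeSM n f g s t : s 0%N = 0 -> t 0%N = 0 ->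
  agree n f g -> agree n.+1 s t -> agree n.+1 (f * s) (g * t).
Proof.
move=> s0 t0 fg st i; rewrite ltnS => le_in; rewrite !coef_fpsM.
apply: eq_bigr => j _.
have [eq_ji|ne_ji] := eqVneq (j : nat) i; first by rewrite eq_ji subnn s0 t0 !mulr0.
by rewrite fg ?st //; have := ltn_ord j; lia.
Qed.

Lemma agreeSM2 n f g s t : f 0%N = 0 -> g 0%N = 0 -> s 0%N = 0 -> t 0%N = 0 ->
  agree n f g -> agree n s t -> agree n.+1 (f * s) (g * t).
Proof.
move=> f0 g0 s0 t0 fg st i; rewrite ltnS => le_in; rewrite !coef_fpsM.
apply: eq_bigr => j _; have lt_ji := ltn_ord j.
have [eq_ji|ne_ji] := eqVneq (j : nat) i; first by rewrite eq_ji subnn s0 t0 !mulr0.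
have [->|ne_j0] := eqVneq (j : nat) 0%N; first by rewrite f0 g0 !mul0r.
by rewrite fg ?st //; lia.
Qed.

Lemma agreeX n s t k : agree n s t -> agree n (s ^+ k) (t ^+ k).
Proof.
move=> st; elim: k => [|k IHk]; first by rewrite !expr0.
by rewrite !exprS; apply: agreeM.
Qed.

Lemma agree_comp n f s t : agree n s t -> agree n (fps_comp f s) (fps_comp f t).
Proof.
move=> st i lt_in; rewrite /=; apply: eq_bigr => k _.
by rewrite (agreeX k st).
Qed.

Section Contraction.
Variable F : fps R -> fps R.
Hypothesis F0 : forall s, s 0%N = 0 -> F s 0%N = 0.
Hypothesis Fcontr : forall n s t, s 0%N = 0 -> t 0%N = 0 ->
  agree n s t -> agree n.+1 (F s) (F t).

Lemma contraction_ex : exists2 s : fps R, s 0%N = 0 & F s = s.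
Proof.
pose it n := iter n F 0.
have it0 n : it n 0%N = 0 by elim: n => // n IHn; apply: F0.
have itP n m : agree n (it n) (it (n + m)%N).
  by elim: n => // n IHn; rewrite addSn; apply: Fcontr.
pose s : fps R := Fps (fun n => it n.+1 n).
have its n : agree n (it n) s.
  by move=> i lt_in /=; have := itP i.+1 (n - i.+1)%N i (ltnSn i); rewrite subnKC.
exists s; first exact: it0.
apply/fpsP => n; have := Fcontr (it0 n) (it0 1%N : s 0%N = 0) (its n) (ltnSn n).
by move=> <-.
Qed.

Lemma contraction_uniq s t : s 0%N = 0 -> t 0%N = 0 -> F s = s -> F t = t -> s = t.
Proof.
move=> s0 t0 Fs Ft; apply/fpsP => n; apply: (_ : agree n.+1 s t) => //.
elim: n.+1 => // {}n IHn; rewrite -Fs -Ft; exact: Fcontr.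
Qed.

End Contraction.

Lemma fps_eq1D f : f 0%N = 1 -> exists2 s : fps R, f = 1 + s & s 0%N = 0.
Proof.
by move=> f0; exists (f - 1); [ring | rewrite coef_fpsB f0 coef_fps1 subrr].
Qed.

Lemma fps_unit f : f 0%N = 1 -> f * rinv f = 1.
Proof.
move=> /fps_eq1D[e -> e0].
have [s s0 sE] : exists2 s : fps R, s 0%N = 0 & - e - e * s = s.
  apply: contraction_ex => [s s0|n s t s0 t0 st].
    by rewrite coef_fpsB coef_fpsN coef_fpsM0 e0 mul0r subr0 oppr0.
  by apply: agreeD => //; apply: agreeN; apply: agreeSM2.
have inv : (1 + e) * (1 + s) = 1.
  have -> : (1 + e) * (1 + s) = 1 + (s - (- e - e * s)) by ring.
  by rewrite sE subrr addr0.
by rewrite (rinvE inv).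
Qed.

Lemma rinv_coef0 f : f 0%N = 1 -> rinv f 0%N = 1.
Proof.
move=> f0; have /fpsP/(_ 0%N) := fps_unit f0.
by rewrite coef_fpsM0 f0 mul1r coef_fps1.
Qed.

End FixedPoint.

(* The square root with constant term 1 of a series with constant term 1;
   existence and uniqueness are [fps_sqrtP] and [fps_sqrt_uniq]. *)
Definition fps_sqrt (R : comPzRingType) (a : fps R) : fps R :=
  xget 0 [set r : fps R | r 0%N = 1 /\ r ^+ 2 = a]%classic.

Definition calR (R : comPzRingType) (p1 p2 p3 p4 : R) : fps R :=
  fps_sqrt (1 + fpsC p1 * fpsX R + fpsC p2 * fpsX R ^+ 2
              + fpsC p3 * fpsX R ^+ 3 + fpsC p4 * fpsX R ^+ 4).

Definition is_calB (R : comPzRingType) (p1 p2 p3 p4 : R) (b : fps R) : Prop :=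
  let mu := fpsX R * rinv b in
  b 0%N = 1 /\ b = fps_comp (calR p1 p2 p3 p4) mu * rinv (fps_deriv mu).

(* Existence and uniqueness are [calBP] and [calB_uniq]. *)
Definition calB (R : comPzRingType) (p1 p2 p3 p4 : R) : fps R :=
  xget 0 [set b : fps R | is_calB p1 p2 p3 p4 b]%classic.

Section QAlgebra.
Variables (R : comPzRingType) (iota : {rmorphism rat -> R}).
Implicit Types f g a r s t : fps R.

Lemma iotaK n : iota (n.+1%:R^-1) * n.+1%:R = 1.
Proof. by rewrite -(rmorph_nat iota n.+1) -rmorphM mulVf ?rmorph1 // pnatr_eq0. Qed.

Lemma sqrt_contraction a : a 0%N = 1 ->
  let F s := fpsC (iota 2%:R^-1) * (a - 1 - s ^+ 2) in
  [/\ forall s, s 0%N = 0 -> F s 0%N = 0,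
      forall n s t, s 0%N = 0 -> t 0%N = 0 -> agree n s t ->
        agree n.+1 (F s) (F t)
    & forall s, F s = s <-> (1 + s) ^+ 2 = a].
Proof.
move=> a0 F; have half : fpsC (iota 2%:R^-1) * 2%:R = 1 :> fps R.
  apply/fpsP => n; rewrite mulr_natr.
  have -> m : (fpsC (iota 2%:R^-1) *+ m) n = (fpsC (iota 2%:R^-1) n) *+ m.
    by elim: m => // m IHm; rewrite !mulrS coef_fpsD IHm.
  by case: n => [|n] /=; rewrite ?mul0rn // -[LHS]mulr_natr iotaK.
split=> [s s0|n s t s0 t0 st|s].
- by rewrite /F coef_fpsM0 !coef_fpsB a0 coef_fps1 expr2 coef_fpsM0 s0 mulr0
    subrr subr0 mulr0.
- rewrite /F; apply: agreeM => //; apply: agreeD => //; apply: agreeN.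
  by rewrite !expr2; apply: agreeSM2.
- rewrite /F; split=> [Fs|<-].
    have : 2%:R * s = a - 1 - s ^+ 2.
      by rewrite -{1}Fs mulrA [2%:R * _]mulrC half mul1r.
    move=> sE; have -> : (1 + s) ^+ 2 = 1 + 2%:R * s + s ^+ 2 by ring.
    by rewrite sE; ring.
  have -> : (1 + s) ^+ 2 - 1 - s ^+ 2 = 2%:R * s by ring.
    by rewrite mulrA half mul1r.
Qed.

Lemma fps_sqrt_uniq a r s : a 0%N = 1 ->
  r 0%N = 1 -> r ^+ 2 = a -> s 0%N = 1 -> s ^+ 2 = a -> r = s.
Proof.
move=> a0; have [F0 Fc FP] := sqrt_contraction a0.
move=> /fps_eq1D[r' -> r0] ra /fps_eq1D[s' -> s0] sa.
by rewrite (contraction_uniq Fc r0 s0) //; apply/FP.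
Qed.

Lemma fps_sqrtP a : a 0%N = 1 -> fps_sqrt a 0%N = 1 /\ fps_sqrt a ^+ 2 = a.
Proof.
move=> a0; have [F0 Fc FP] := sqrt_contraction a0.
have [s s0 /FP sa] := contraction_ex F0 Fc.
apply: (@xgetI _ 0 [set r : fps R | r 0%N = 1 /\ r ^+ 2 = a]%classic (1 + s)).
by split=> //; rewrite coef_fpsD s0 coef_fps1 addr0.
Qed.

Variables p1 p2 p3 p4 : R.
Local Notation calR := (calR p1 p2 p3 p4).

Lemma calR0 : calR 0%N = 1.
Proof.
apply: (fps_sqrtP _).1; rewrite !coef_fpsD coef_fps1 !exprS expr0 !mulr1.
by rewrite !coef_fpsM0 /= !mul0r !mulr0 !addr0.
Qed.

Lemma fpsXM m n : (fpsX R * m) n = if n is k.+1 then m k else 0.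
Proof.
rewrite coef_fpsM; case: n => [|n]; first by rewrite big_ord1 /= mul0r.
rewrite big_ord_recl /= mul0r add0r big_ord_recl /= mul1r subSS subn0.
by rewrite big1 ?addr0 // => i _; rewrite mul0r.
Qed.

Lemma calR_comp0 g : fps_comp calR g 0%N = 1.
Proof. by rewrite /= big_ord1 expr0 coef_fps1 mulr1 calR0. Qed.

Let G s : fps R := (1 + s) * (fps_comp calR (fpsX R * (1 + s)) - 1).
Let F s : fps R := Fps (fun n => if n is k.+1 then iota n%:R^-1 * G s n else 0).

Lemma calB_fixP s : s 0%N = 0 -> F s = s <->
  fps_deriv (fpsX R * (1 + s)) = (1 + s) * fps_comp calR (fpsX R * (1 + s)).
Proof.
move=> s0; have dE n : fps_deriv (fpsX R * (1 + s)) n = (1 + s) n *+ n.+1.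
  by rewrite coef_fps_deriv fpsXM.
have gE n : ((1 + s) * fps_comp calR (fpsX R * (1 + s))) n = (1 + s) n + G s n.
  rewrite -coef_fpsD; congr (fps_coef _ n); rewrite /G; ring.
have G0 : G s 0%N = 0.
  by rewrite /G coef_fpsM0 coef_fpsB calR_comp0 coef_fps1 subrr mulr0.
have s1 n : (1 + s) n.+1 = s n.+1 by rewrite coef_fpsD coef_fps1 add0r.
have F1 n : F s n.+1 = iota n.+1%:R^-1 * G s n.+1 by [].
split=> [Fs|Es]; apply/fpsP => n.
  rewrite dE gE mulrS; congr (_ + _); case: n => [|n]; first by rewrite G0.
  by rewrite s1 -[in LHS]Fs F1 -[LHS]mulr_natr mulrAC iotaK mul1r.
case: n => [|n]; first by rewrite s0.
have := dE n.+1; rewrite Es gE mulrS s1 => /addrI GE.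
by rewrite F1 GE -[s n.+1 *+ n.+1]mulr_natr mulrCA iotaK mulr1.
Qed.

Lemma calB_contraction n s t : s 0%N = 0 -> t 0%N = 0 -> agree n s t ->
  agree n.+1 (F s) (F t).
Proof.
move=> s0 t0 st; have st1 : agree n (1 + s) (1 + t) by apply: agreeD.
have Gst : agree n.+1 (G s) (G t).
  rewrite /G; apply: agreeSM => //.
  - by rewrite coef_fpsB calR_comp0 coef_fps1 subrr.
  - by rewrite coef_fpsB calR_comp0 coef_fps1 subrr.
  apply: agreeD => //; apply: agree_comp => -[|j] lt_jn; rewrite !fpsXM //.
  exact: st1.
by move=> [//|i] lt_in; congr (_ * _); apply: Gst.
Qed.

Lemma deriv_fpsXM0 m : fps_deriv (fpsX R * m) 0%N = m 0%N.
Proof. by rewrite coef_fps_deriv fpsXM. Qed.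

Lemma calBP : is_calB p1 p2 p3 p4 (calB p1 p2 p3 p4).
Proof.
have [s s0 Fs] : exists2 s : fps R, s 0%N = 0 & F s = s.
  by apply: contraction_ex; [move=> s _ | exact: calB_contraction].
have m0 : (1 + s) 0%N = 1 by rewrite coef_fpsD s0 coef_fps1 addr0.
apply: (@xgetI _ 0 [set b : fps R | is_calB p1 p2 p3 p4 b]%classic (rinv (1 + s))).
split; first exact: rinv_coef0.
rewrite (_ : rinv (rinv (1 + s)) = 1 + s); last first.
  by apply: rinvE; rewrite mulrC fps_unit.
move/(calB_fixP s0): Fs => E; set mu := fpsX R * _ in E *.
have mu0 : fps_deriv mu 0%N = 1 by rewrite /mu deriv_fpsXM0.
transitivity (rinv (1 + s) * (fps_deriv mu * rinv (fps_deriv mu))).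
  by rewrite (fps_unit mu0) mulr1.
by rewrite {1}E 2!mulrA [rinv _ * _]mulrC (fps_unit m0) mul1r.
Qed.

Lemma calB_uniq b b' : is_calB p1 p2 p3 p4 b -> is_calB p1 p2 p3 p4 b' -> b = b'.
Proof.
have fixb c : is_calB p1 p2 p3 p4 c ->
  exists2 s : fps R, s 0%N = 0 & c * (1 + s) = 1 /\ F s = s.
  case=> c0 cE; have [s mE s0] := fps_eq1D (rinv_coef0 c0).
  exists s => //; split; first by rewrite -mE fps_unit.
  apply/(calB_fixP s0); rewrite -mE; set mu := fpsX R * _ in cE *.
  have mu0 : fps_deriv mu 0%N = 1 by rewrite /mu deriv_fpsXM0 rinv_coef0.
  transitivity (rinv c * c * fps_deriv mu).
    by rewrite [rinv c * c]mulrC (fps_unit c0) mul1r.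
  rewrite {2}cE -!mulrA; congr (_ * _).
  by rewrite [rinv (fps_deriv _) * _]mulrC (fps_unit mu0) mulr1.
move=> /fixb[s s0 [bs Fs]] /fixb[t t0 [bt Ft]].
have st : s = t by apply: (contraction_uniq calB_contraction).
by rewrite -[b]mulr1 -bt -st mulrCA bs mulr1.
Qed.

End QAlgebra.

(* Formal Laurent series: coefficient families indexed by int that vanish in
   all sufficiently negative degrees. *)
Record laurent (R : comPzRingType) := Laurent {
  laurent_coef :> int -> R;
  laurent_bound : exists N : int, forall n, n < N -> laurent_coef n = 0
}.

Section LaurentRing.
Variable R : comPzRingType.
Implicit Types (a b c : laurent R) (f g h : fps R).

HB.instance Definition _ := gen_eqMixin (laurent R).
HB.instance Definition _ := gen_choiceMixin (laurent R).

Lemma laurentP a b : (forall n, a n = b n) <-> a = b.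
Proof.
split=> [|-> //]; case: a b => [a aP] [b bP] /= /funext ab.
by case: _ / ab in bP *; congr Laurent; apply: Prop_irrelevance.
Qed.

Fact laurent_zero_bound : exists N : int, forall n, n < N -> 0 = 0 :> R.
Proof. by exists 0. Qed.
Definition laurent_zero : laurent R := Laurent laurent_zero_bound.

Fact laurent_opp_bound a : exists N : int, forall n, n < N -> - a n = 0.
Proof. by case: (laurent_bound a) => N aN; exists N => n /aN->; rewrite oppr0. Qed.
Definition laurent_opp a : laurent R := Laurent (laurent_opp_bound a).

Fact laurent_add_bound a b : exists N : int, forall n, n < N -> a n + b n = 0.
Proof.
case: (laurent_bound a) (laurent_bound b) => [N aN] [M bM].
by exists (Order.min N M) => n; rewrite lt_min => /andP[/aN-> /bM->]; rewrite addr0.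
Qed.
Definition laurent_add a b : laurent R := Laurent (laurent_add_bound a b).

Fact laurent_addA : associative laurent_add.
Proof. by move=> a b c; apply/laurentP => n /=; rewrite addrA. Qed.
Fact laurent_addC : commutative laurent_add.
Proof. by move=> a b; apply/laurentP => n /=; rewrite addrC. Qed.
Fact laurent_add0 : left_id laurent_zero laurent_add.
Proof. by move=> a; apply/laurentP => n /=; rewrite add0r. Qed.
Fact laurent_addN : left_inverse laurent_zero laurent_opp laurent_add.
Proof. by move=> a; apply/laurentP => n /=; rewrite addNr. Qed.

HB.instance Definition _ := GRing.isZmodule.Build (laurent R)
  laurent_addA laurent_addC laurent_add0 laurent_addN.

Fact laurent_mul_bound a b :
  exists N : int, forall n, n < N -> \sum_(i \in setT) a i * b (n - i) = 0.
Proof.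
case: (laurent_bound a) (laurent_bound b) => [N aN] [M bM].
exists (N + M) => n lt_n; apply: fsbig1 => i _.
have [/aN ->|le_Ni] := ltP i N; first by rewrite mul0r.
by rewrite bM ?mulr0 //; lia.
Qed.

(* The sum over all i in int has finite support. *)
Definition laurent_mul a b : laurent R := Laurent (laurent_mul_bound a b).

(* x^(-m) f(x) *)
Definition shift_coef (m : nat) f (n : int) : R :=
  if n + m%:Z is Posz k then f k else 0.

Fact shift_bound m f : exists N : int, forall n, n < N -> shift_coef m f n = 0.
Proof.
exists (- m%:Z) => n lt_n; rewrite /shift_coef.
by case E: (n + m%:Z) => [k|//]; lia.
Qed.
Definition laurent_shift m f : laurent R := Laurent (shift_bound m f).

Definition laurent_of_fps f : laurent R := laurent_shift 0 f.
Definition laurentC (c : R) : laurent R := laurent_of_fps (fpsC c).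

Lemma laurent_shiftE m f (n : int) (k : nat) :
  n + m%:Z = k%:Z -> laurent_shift m f n = f k.
Proof. by move=> nm; rewrite /= /shift_coef nm. Qed.

Lemma laurent_shift_lt m f (n : int) : n + m%:Z < 0 -> laurent_shift m f n = 0.
Proof. by rewrite /= /shift_coef; case: (n + _). Qed.

Lemma laurent_shift_ex a : exists m f, a = laurent_shift m f.
Proof.
case: (laurent_bound a) => N aN.
exists `|N|%N, (Fps (fun k => a (k%:Z - `|N|%N%:Z))); apply/laurentP => n.
have [lt_n|le_n] := ltP (n + `|N|%N%:Z) 0.
  by rewrite laurent_shift_lt // aN //; lia.
rewrite (@laurent_shiftE _ _ _ `|(n + `|N|%N%:Z)%R|%N) /=; last by lia.
by congr (laurent_coef a _); lia.
Qed.

Lemma laurent_shiftM m k f g :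
  laurent_mul (laurent_shift m f) (laurent_shift k g) =
  laurent_shift (m + k) (f * g).
Proof.
apply/laurentP => n.
rewrite -[LHS]/(\sum_(i \in setT) laurent_shift m f i * laurent_shift k g (n - i)).
have [lt_n|le_n] := ltP (n + (m + k)%N%:Z) 0.
  rewrite laurent_shift_lt //; apply: fsbig1 => i _.
  have [lt_i|le_i] := ltP (i + m%:Z) 0; first by rewrite laurent_shift_lt // mul0r.
  by rewrite [laurent_shift k g _]laurent_shift_lt ?mulr0 //; lia.
have [N nN] : {N : nat | n + (m + k)%N%:Z = N%:Z}.
  by exists `|(n + (m + k)%N%:Z)%R|%N; lia.
rewrite (laurent_shiftE _ nN) coef_fpsM.
rewrite (fsbigE [seq j%:Z - m%:Z | j <- iota 0 N.+1]); first last.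
- move=> i _ iN.
  have [lt_i|le_i] := ltP (i + m%:Z) 0; first by rewrite laurent_shift_lt // mul0r.
  have [lt_j|le_j] := ltP (n - i + k%:Z) 0.
    by rewrite [laurent_shift k g _]laurent_shift_lt ?mulr0.
  case/negP: iN; apply/mapP; exists `|(i + m%:Z)%R|%N; last by lia.
  by rewrite mem_iota; lia.
- by [].
- by rewrite map_inj_uniq ?iota_uniq // => i j; lia.
rewrite big_map -[iota 0 N.+1]/(index_iota 0 N.+1) big_mkord.
apply: eq_big => [i|i _]; first by rewrite in_setT.
have lt_i := ltn_ord i; rewrite (@laurent_shiftE _ _ _ i) ?subrK //.
by rewrite (@laurent_shiftE _ _ _ (N - i)%N) //; lia.
Qed.

Lemma laurent_shift_mulX m d f :
  laurent_shift m f = laurent_shift (m + d) (fpsX R ^+ d * f).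
Proof.
elim: d => [|d ->]; first by rewrite addn0 expr0 mul1r.
rewrite addnS exprS -mulrA; set g := _ * f; set l := (m + d)%N.
apply/laurentP => n; have [lt_n|le_n] := ltP (n + l.+1%:Z) 0.
  by rewrite !laurent_shift_lt //; lia.
have [[|N] nN] : {N : nat | n + l.+1%:Z = N%:Z}.
- by exists `|(n + l.+1%:Z)%R|%N; lia.
- by rewrite (laurent_shiftE _ nN) fpsXM laurent_shift_lt //; lia.
by rewrite (laurent_shiftE _ nN) fpsXM (@laurent_shiftE _ _ _ N) //; lia.
Qed.

Lemma laurent_shiftD m f g :
  laurent_add (laurent_shift m f) (laurent_shift m g) = laurent_shift m (f + g).
Proof.
by apply/laurentP => n /=; rewrite /shift_coef; case: (n + _) => //; rewrite addr0.
Qed.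

Lemma laurent_shift_ex2 a b :
  exists m f g, a = laurent_shift m f /\ b = laurent_shift m g.
Proof.
case: (laurent_shift_ex a) (laurent_shift_ex b) => [m [f ->]] [k [g ->]].
exists (m + k)%N, (fpsX R ^+ k * f), (fpsX R ^+ m * g).
by rewrite -laurent_shift_mulX addnC -laurent_shift_mulX.
Qed.

Fact laurent_mulA : associative laurent_mul.
Proof.
move=> a b c; have [m [f ->]] := laurent_shift_ex a.
have [k [g ->]] := laurent_shift_ex b; have [l [h ->]] := laurent_shift_ex c.
by rewrite !laurent_shiftM mulrA addnA.
Qed.

Fact laurent_mulC : commutative laurent_mul.
Proof.
move=> a b; have [m [f ->]] := laurent_shift_ex a.
by have [k [g ->]] := laurent_shift_ex b; rewrite !laurent_shiftM mulrC addnC.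
Qed.

Fact laurent_mul1 : left_id (laurent_of_fps 1) laurent_mul.
Proof.
move=> a; have [m [f ->]] := laurent_shift_ex a.
by rewrite laurent_shiftM mul1r add0n.
Qed.

Fact laurent_mulDl : left_distributive laurent_mul laurent_add.
Proof.
move=> a b c; have [m [f [g [-> ->]]]] := laurent_shift_ex2 a b.
have [k [h ->]] := laurent_shift_ex c.
by rewrite laurent_shiftD !laurent_shiftM laurent_shiftD mulrDl.
Qed.

HB.instance Definition _ := GRing.Zmodule_isComPzRing.Build (laurent R)
  laurent_mulA laurent_mulC laurent_mul1 laurent_mulDl.

Fact laurent_deriv_bound a :
  exists N : int, forall n, n < N -> a (n + 1) *~ (n + 1) = 0.
Proof.
case: (laurent_bound a) => N aN; exists (N - 1) => n lt_n.
by rewrite aN ?mul0rz //; lia.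
Qed.
Definition laurent_deriv a : laurent R := Laurent (laurent_deriv_bound a).

(* f'/f in R((x)); see [logderivP]. *)
Definition logderiv f : laurent R :=
  laurent_of_fps (fps_deriv f) * rinv (laurent_of_fps f).

Lemma laurent_of_fps_unit f : f 0%N = 0 -> f 1%N = 1 ->
  laurent_of_fps f * rinv (laurent_of_fps f) = 1.
Proof.
move=> f0 f1; pose g : fps R := Fps (fun n => f n.+1).
have fE : f = fpsX R * g.
  by apply/fpsP => -[|n]; rewrite fpsXM.
suff inv : laurent_of_fps f * laurent_shift 1 (rinv g) = 1 by rewrite (rinvE inv).
rewrite [LHS]laurent_shiftM fE -mulrA fps_unit //.
by rewrite add0n -{1}[1%N]add0n -(expr1 (fpsX R)) -laurent_shift_mulX.
Qed.

Lemma logderivP f : f 0%N = 0 -> f 1%N = 1 ->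
  logderiv f * laurent_of_fps f = laurent_of_fps (fps_deriv f).
Proof.
by move=> f0 f1; rewrite /logderiv mulrAC -mulrA laurent_of_fps_unit // mulr1.
Qed.

End LaurentRing.

Definition is_comp_inverse (R : comPzRingType) (f g : fps R) : Prop :=
  [/\ f 0%N = 0, g 0%N = 0, fps_comp f g = fpsX R & fps_comp g f = fpsX R].

(* In R[[u, v]] the denominator has lowest term u - v (when f = u + ...); it is
   not a unit, hence the use of [is_quotient]. *)
Definition has_addition_theorem (R : comPzRingType) (f : fps R) : Prop :=
  exists xi1 xi2 : fps R,
  [/\ xi1 0%N = 1, xi2 0%N = 1
    & let at_u g := fps_comp2 g (varu R) in
      let at_v g := fps_comp2 g (varv R) in
      is_quotient (fps_comp2 f (varu R + varv R))
        (at_u f ^+ 2 * at_v xi1 - at_v f ^+ 2 * at_u xi1)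
        (at_u f * at_v xi2 - at_v f * at_u xi2)].

(* S(t) for t in the R-algebra R((x)). *)
Definition quarticS (R : comPzRingType) (p1 p2 p3 p4 : R) (t : laurent R) :
    laurent R :=
  laurentC p4 + laurentC p3 * t + laurentC p2 * t ^+ 2 + laurentC p1 * t ^+ 3
    + t ^+ 4.

(* Main.v *)
Require Import Defs.
From HB Require Import structures.
From mathcomp Require Import all_boot all_order all_algebra.
From mathcomp Require Import zify ring.
From mathcomp Require Import all_classical.

(* Put h = f'/f.  Multiplying (h')^2 = S(h) by f^4 gives a polynomial
   differential equation for f, [quartic_ode], which has the same content in
   terms of g = 1/h = f/f', namely g'^2 = 1 + p1 g + p2 g^2 + p3 g^3 + p4 g^4.
   If f' = b(f) and mu = x/b then g = mu(f) and g' = (b mu')(f), so g' = R(g)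
   says that b satisfies the equation defining the series B.

   From the addition theorem, the coefficients of v and v^2 express xi2 and xi1
   through f, and that of v^3 then becomes an equation h'' = cubic(h); times 2h'
   it integrates to h'^2 = S(h), p4 being the constant of integration.

   Conversely the coefficients above dictate the choice xi2 = f',
   xi1 = f'^2 - f f''/2 - f_2 f f'.  Writing N and D for the resulting numerator
   and denominator, h'^2 = S(h) and 2h'' = S'(h) imply
   (d/dv - d/du)(N/D) = 0.  So N/D depends on u + v only, and it equals f(u) at
   v = 0. *)

Set Implicit Arguments.
Unset Strict Implicit.
Unset Printing Implicit Defensive.

Import Order.TTheory GRing.Theory Num.Theory.
Local Open Scope ring_scope.

(** * Formal power series: derivation, regular elements, composition and compositional inverses *)

Section Series.
Variable R : comPzRingType.
Implicit Types f g s t : fps R.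

Lemma fpsCM (c d : R) : fpsC (c * d) = fpsC c * fpsC d.
Proof.
apply/fpsP => n; rewrite coef_fpsM big_ord_recl subn0 big1 ?addr0.
  by case: n => [|n] //=; rewrite mulr0.
by move=> i _; rewrite mul0r.
Qed.

Lemma fpsCD (c d : R) : fpsC (c + d) = fpsC c + fpsC d.
Proof. by apply/fpsP => -[|n] //=; rewrite addr0. Qed.

Fact fpsC_nmod_morphism : nmod_morphism (@fpsC R).
Proof. by split=> [|c d]; [apply/fpsP => -[] | apply: fpsCD]. Qed.
HB.instance Definition _ :=
  GRing.isNmodMorphism.Build R (fps R) (@fpsC R) fpsC_nmod_morphism.
Fact fpsC_monoid_morphism : monoid_morphism (@fpsC R).
Proof. by split=> // c d; apply: fpsCM. Qed.
HB.instance Definition _ :=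
  GRing.isMonoidMorphism.Build R (fps R) (@fpsC R) fpsC_monoid_morphism.

Lemma coef_fpsCM (c : R) f n : (fpsC c * f) n = c * f n.
Proof.
rewrite coef_fpsM big_ord_recl subn0 big1 ?addr0 // => i _.
by rewrite mul0r.
Qed.

Lemma coef_fpsMn f m n : (f *+ m) n = f n *+ m.
Proof. by elim: m => // m IHm; rewrite !mulrS coef_fpsD IHm. Qed.

Lemma fps_derivD f g : fps_deriv (f + g) = fps_deriv f + fps_deriv g.
Proof. by apply/fpsP => n; rewrite /= mulrnDl. Qed.

Fact fps_deriv_nmod_morphism : nmod_morphism (@fps_deriv R).
Proof.
by split=> [|f g]; [apply/fpsP => n /=; rewrite mul0rn | apply: fps_derivD].
Qed.
HB.instance Definition _ :=
  GRing.isNmodMorphism.Build (fps R) (fps R) (@fps_deriv R)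
    fps_deriv_nmod_morphism.

Lemma fps_derivB f g : fps_deriv (f - g) = fps_deriv f - fps_deriv g.
Proof. exact: raddfB. Qed.

Lemma fps_derivMn f n : fps_deriv (f *+ n) = fps_deriv f *+ n.
Proof. exact: raddfMn. Qed.

Lemma fps_derivM f g : fps_deriv (f * g) = fps_deriv f * g + f * fps_deriv g.
Proof.
apply/fpsP => n; rewrite coef_fps_deriv coef_fpsD !coef_fpsM.
have -> : (\sum_(i < n.+2) f i * g (n.+1 - i)%N) *+ n.+1 =
    \sum_(i < n.+2) (f i *+ i) * g (n.+1 - i)%N +
    \sum_(i < n.+2) f i * (g (n.+1 - i)%N *+ (n.+1 - i)).
  rewrite -sumrMnl -big_split /=; apply: eq_bigr => i _.
  by rewrite mulrnAl mulrnAr -mulrnDr subnKC // -ltnS.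
rewrite big_ord_recl mulr0n mul0r add0r; congr (_ + _).
rewrite big_ord_recr /= subnn mulr0n mulr0 addr0; apply: eq_bigr => i _.
by rewrite subSn // -ltnS.
Qed.

Lemma fps_derivC (c : R) : fps_deriv (fpsC c) = 0.
Proof. by apply/fpsP => n; rewrite /= mul0rn. Qed.

Lemma fps_derivX : fps_deriv (fpsX R) = 1.
Proof. by apply/fpsP => -[|n] //=; rewrite mul0rn. Qed.

Lemma fps_derivCM (c : R) f : fps_deriv (fpsC c * f) = fpsC c * fps_deriv f.
Proof. by rewrite fps_derivM fps_derivC mul0r add0r. Qed.

(** Once the coefficients of [s] below [n] vanish, coefficient [n] of [f * s] is [f 0 * s n]. *)
Lemma fps_lreg f : GRing.lreg (f 0%N) -> GRing.lreg f.
Proof.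
move=> f0 s t; move=> /eqP; rewrite -subr_eq0 -mulrBr => /eqP fst.
apply/eqP; rewrite -subr_eq0; apply/eqP; move: (s - t) fst => {s t} s fs0.
apply/fpsP => n; elim/ltn_ind: n => n IHn.
have /fpsP/(_ n) := fs0; rewrite coef_fpsM big_ord_recl subn0 big1 => [|i _].
  by rewrite addr0 -[RHS](mulr0 (f 0%N)) => /f0.
by have lt_in := ltn_ord i; rewrite IHn ?mulr0 // lift0; lia.
Qed.

Lemma fps_lreg1 f : f 0%N = 1 -> GRing.lreg f.
Proof. by move=> f0; apply: fps_lreg; rewrite f0; apply: lreg1. Qed.

(** The quotient [(f - f(0)) / x], the tail in a Horner scheme. *)
Definition fps_shift f : fps R := Fps (fun n => f n.+1).

Lemma fps_shiftE f : f = fpsC (f 0%N) + fpsX R * fps_shift f.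
Proof. by apply/fpsP => -[|n]; rewrite coef_fpsD fpsXM ?addr0 //= add0r. Qed.

Lemma fps_mulX_shift f : fpsX R * fps_shift f = f - fpsC (f 0%N).
Proof. by rewrite {2}[f]fps_shiftE addrC addKr. Qed.

Lemma fpsX_lreg : GRing.lreg (fpsX R).
Proof.
by move=> s t /fpsP st; apply/fpsP => n; have := st n.+1; rewrite !fpsXM.
Qed.

Lemma fps_lregX f : f 0%N = 0 -> f 1%N = 1 -> GRing.lreg f.
Proof.
move=> f0 f1; rewrite [f]fps_shiftE f0 rmorph0 add0r.
by apply: lregM; [apply: fpsX_lreg | apply: fps_lreg1].
Qed.

Lemma coef_exp_lt g k n : g 0%N = 0 -> (n < k)%N -> (g ^+ k) n = 0.
Proof.
move=> g0; elim: k n => // k IHk n lt_nk; rewrite exprS coef_fpsM big1 // => i _.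
have [->|ne0] := eqVneq (i : nat) 0%N; first by rewrite g0 mul0r.
by rewrite IHk ?mulr0 //; have := ltn_ord i; lia.
Qed.

Lemma coef_exp_diag g n : g 0%N = 0 -> (g ^+ n) n = g 1%N ^+ n.
Proof.
move=> g0; elim: n => [|n IHn]; first by rewrite !expr0 coef_fps1.
rewrite !exprS coef_fpsM !big_ord_recl g0 mul0r add0r /= subSS subn0 IHn.
rewrite big1 ?addr0 // => i _; rewrite coef_exp_lt ?mulr0 //.
by have := ltn_ord i; rewrite /bump /=; lia.
Qed.

Section Composition.
Variable g : fps R.
Hypothesis g0 : g 0%N = 0.

Lemma coef_fps_comp f n m : (n < m)%N ->
  fps_comp f g n = \sum_(k < m) f k * (g ^+ k) n.
Proof.
move=> lt_nm; rewrite /= (big_ord_widen _ (fun k => f k * (g ^+ k) n) lt_nm).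
rewrite big_mkcond /=; apply: eq_bigr => k _; case: ltnP => // lt_nk.
by rewrite coef_exp_lt ?mulr0.
Qed.

(** The recursion behind multiplicativity, the chain rule and associativity of composition: [g] has
    no constant term, so agreement of the tails below degree [n] gives agreement below [n.+1], and
    one inducts on the precision. *)
Lemma fps_comp_horner f :
  fps_comp f g = fpsC (f 0%N) + g * fps_comp (fps_shift f) g.
Proof.
apply/fpsP => n; rewrite coef_fpsD -[LHS]/(\sum_(k < n.+1) f k * (g ^+ k) n).
rewrite big_ord_recl expr0 coef_fps1; congr (_ + _).
  by case: n => [|n]; rewrite ?mulr1 ?mulr0.
rewrite coef_fpsM.
transitivity (\sum_(i < n.+1) g i * \sum_(k < n) f k.+1 * (g ^+ k) (n - i)%N).
  under eq_bigr => k _ do rewrite /= /bump add1n exprS coef_fpsM mulr_sumr.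
  rewrite exchange_big /=; apply: eq_bigr => i _; rewrite mulr_sumr.
  by apply: eq_bigr => k _; rewrite mulrCA.
apply: eq_bigr => -[[|i] lt_in] _ /=; first by rewrite g0 !mul0r.
congr (_ * _); rewrite -[RHS]/(fps_comp (fps_shift f) g (n - i.+1)%N).
by rewrite (@coef_fps_comp _ _ n) //; lia.
Qed.

Lemma fps_comp0 f : fps_comp f g 0%N = f 0%N.
Proof. by rewrite fps_comp_horner coef_fpsD coef_fpsM0 g0 mul0r addr0. Qed.

Lemma agree_mul0 n s t : agree n s t -> agree n.+1 (g * s) (g * t).
Proof. by move=> st; rewrite ![g * _]mulrC; apply: agreeSM. Qed.

Lemma agree_eq s t : (forall n, agree n s t) -> s = t.
Proof. by move=> st; apply/fpsP => n; apply: (st n.+1). Qed.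

Lemma fps_compD f s : fps_comp (f + s) g = fps_comp f g + fps_comp s g.
Proof.
by apply/fpsP => n; rewrite /= -big_split /=; apply: eq_bigr => k _; rewrite mulrDl.
Qed.

Lemma fps_compCM (c : R) f : fps_comp (fpsC c * f) g = fpsC c * fps_comp f g.
Proof.
apply/fpsP => n; rewrite coef_fpsCM mulr_sumr; apply: eq_bigr => k _.
by rewrite coef_fpsCM mulrA.
Qed.

Lemma fps_compC (c : R) : fps_comp (fpsC c) g = fpsC c.
Proof.
rewrite fps_comp_horner; rewrite (_ : fps_comp _ g = 0) ?mulr0 ?addr0 //.
by apply/fpsP => n /=; rewrite big1 // => k _; rewrite mul0r.
Qed.

Lemma fps_comp1 : fps_comp 1 g = 1.
Proof. exact: fps_compC. Qed.

Lemma fps_compX : fps_comp (fpsX R) g = g.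
Proof.
rewrite fps_comp_horner (_ : fps_shift _ = 1).
  by rewrite fps_comp1 mulr1 rmorph0 add0r.
by apply/fpsP => -[].
Qed.

Lemma fps_compM f s : fps_comp (f * s) g = fps_comp f g * fps_comp s g.
Proof.
apply: agree_eq => n; elim: n f s => // n IHn f s.
(* A product rule for tails; the induction hypothesis then applies to [fps_shift f] and [s]. *)
have sE : fps_shift (f * s) = fpsC (f 0%N) * fps_shift s + fps_shift f * s.
  apply: fpsX_lreg; rewrite mulrDr mulrCA [_ * (_ * s)]mulrA !fps_mulX_shift.
  by rewrite coef_fpsM0 fpsCM; ring.
rewrite fps_comp_horner sE fps_compD fps_compCM coef_fpsM0 fpsCM.
have -> : fps_comp f g * fps_comp s g = fpsC (f 0%N) * fpsC (s 0%N) +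
   g * (fpsC (f 0%N) * fps_comp (fps_shift s) g
        + fps_comp (fps_shift f) g * fps_comp s g).
  by rewrite (fps_comp_horner f) (fps_comp_horner s); ring.
by apply: agreeD => //; apply: agree_mul0; apply: agreeD => //; apply: IHn.
Qed.

Lemma fps_compXn f n : fps_comp (f ^+ n) g = fps_comp f g ^+ n.
Proof.
by elim: n => [|n IHn]; rewrite ?expr0 ?fps_comp1 // !exprS fps_compM IHn.
Qed.

Lemma fps_deriv_comp f :
  fps_deriv (fps_comp f g) = fps_deriv g * fps_comp (fps_deriv f) g.
Proof.
apply: agree_eq => n; elim: n f => // n IHn f.
have -> : fps_deriv f = fps_shift f + fpsX R * fps_deriv (fps_shift f).
  rewrite {1}[f]fps_shiftE fps_derivD fps_derivC fps_derivM fps_derivX.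
  by rewrite mul1r add0r.
rewrite fps_comp_horner fps_derivD fps_derivC add0r fps_derivM fps_compD.
rewrite fps_compM fps_compX mulrDr mulrCA.
by apply: agreeD => //; apply: agree_mul0.
Qed.

Lemma fps_comp_rinv f : f 0%N = 1 -> fps_comp f g * fps_comp (rinv f) g = 1.
Proof. by move=> f0; rewrite -fps_compM fps_unit // fps_comp1. Qed.

End Composition.

Lemma fps_compA f g s : g 0%N = 0 -> s 0%N = 0 ->
  fps_comp (fps_comp f g) s = fps_comp f (fps_comp g s).
Proof.
move=> g0 s0; have gs0 : fps_comp g s 0%N = 0 by rewrite fps_comp0.
apply: agree_eq => n; elim: n f => // n IHn f.
rewrite (fps_comp_horner g0) (fps_comp_horner gs0) fps_compD fps_compC //.
by rewrite fps_compM //; apply: agreeD => //; apply: agree_mul0.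
Qed.

Lemma fps_compX_r f : fps_comp f (fpsX R) = f.
Proof.
apply: agree_eq => n; elim: n f => // n IHn f; rewrite {2}[f]fps_shiftE.
by rewrite fps_comp_horner //; apply: agreeD => //; apply: agree_mul0.
Qed.

(** With [f = x + x e] and [e(0) = 0], the equation [f(g) = x] becomes the fixed-point equation
    [g = x - g e(g)], a contraction because [g] and [e(g)] both have constant term 0. *)
Lemma comp_rinverse_ex f : f 0%N = 0 -> f 1%N = 1 ->
  exists g : fps R, [/\ g 0%N = 0, g 1%N = 1 & fps_comp f g = fpsX R].
Proof.
move=> f0 f1.
pose e := fps_shift f - 1; have e0 : e 0%N = 0 by rewrite coef_fpsB /= f1 subrr.
have fE : f = fpsX R + fpsX R * e.
  by rewrite {1}[f]fps_shiftE f0 rmorph0 /e; ring.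
have [g g0 gE] : exists2 g : fps R, g 0%N = 0 & fpsX R - g * fps_comp e g = g.
  apply: contraction_ex => [g g0|n s t s0 t0 st].
    by rewrite coef_fpsB coef_fpsM0 g0 mul0r subr0.
  apply: agreeD => //; apply: agreeN; apply: agreeSM2; rewrite ?fps_comp0 //.
  exact: agree_comp.
exists g; split => //.
  rewrite -gE coef_fpsB coef_fpsM !big_ord_recl big_ord0 fps_comp0 // e0 g0.
  by rewrite mulr0 mul0r !addr0 subr0.
by rewrite fE fps_compD fps_compM // fps_compX // -[X in X + _]gE subrK.
Qed.

(** The right inverse [g] of [f] has a right inverse [k] in turn, and associativity gives
    [f = f(g(k)) = k]. *)
Lemma comp_inverse_ex f : f 0%N = 0 -> f 1%N = 1 ->
  exists g, is_comp_inverse f g.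
Proof.
move=> f0 f1; have [g [g0 g1 fg]] := comp_rinverse_ex f0 f1.
have [k [k0 _ gk]] := comp_rinverse_ex g0 g1.
exists g; split=> //; suff -> : f = k by [].
by rewrite -[f]fps_compX_r -gk -fps_compA // fg fps_compX.
Qed.

Lemma fps_comp_inj f s t : f 0%N = 0 -> f 1%N = 1 ->
  fps_comp s f = fps_comp t f -> s = t.
Proof.
move=> f0 f1 st; have [g [_ g0 fg _]] := comp_inverse_ex f0 f1.
by rewrite -[s]fps_compX_r -[t]fps_compX_r -fg -!fps_compA // st.
Qed.

End Series.

(** * Series over a Q-algebra: the equation [f' = B(f)] and the quartic equation for [f] *)

Section RationalSeries.
Variables (R : comPzRingType) (iota : {rmorphism rat -> R}).
Implicit Types f g s t : fps R.

Lemma mulrSn_eq0 n (x : R) : x *+ n.+1 = 0 -> x = 0.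
Proof.
by move=> xn; rewrite -[x]mul1r -(iotaK iota n) -mulrA mulr_natl xn mulr0.
Qed.

Lemma fps_mulrSn_eq0 n s : s *+ n.+1 = 0 -> s = 0.
Proof.
move=> /fpsP sn; apply/fpsP => k; apply: (@mulrSn_eq0 n).
by rewrite -coef_fpsMn sn.
Qed.

Lemma fps_deriv_inj s t : s 0%N = t 0%N -> fps_deriv s = fps_deriv t -> s = t.
Proof.
move=> st0 /fpsP st; apply/fpsP => -[|n] //; apply/eqP; rewrite -subr_eq0.
by apply/eqP/(@mulrSn_eq0 n); apply/eqP; rewrite mulrnBl subr_eq0;
  apply/eqP/st.
Qed.

Lemma fps_deriv_int s : fps_deriv (fps_int iota s) = s.
Proof.
by apply/fpsP => n; rewrite coef_fps_deriv /= -[LHS]mulr_natr mulrAC iotaK mul1r.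
Qed.

(** By the chain rule [I(f)] has derivative [f' / b(f)], so [I(f) = x] exactly when [f' = b(f)]; a
    left inverse of [f] then equals its two-sided inverse. *)
Lemma comp_inverse_intP (b f : fps R) : b 0%N = 1 -> f 0%N = 0 -> f 1%N = 1 ->
  is_comp_inverse f (fps_int iota (rinv b)) <-> fps_deriv f = fps_comp b f.
Proof.
move=> b0 f0 f1; set I := fps_int iota _.
have DI : fps_deriv (fps_comp I f) = fps_deriv f * fps_comp (rinv b) f.
  by rewrite fps_deriv_comp // fps_deriv_int.
split=> [[_ _ _ If]|fE].
  rewrite -[LHS]mulr1 -(fps_comp_rinv f0 b0) [fps_comp b f * _]mulrC mulrA -DI If.
  by rewrite fps_derivX mul1r.
have If : fps_comp I f = fpsX R.
  apply: fps_deriv_inj; first by rewrite fps_comp0.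
  by rewrite DI fE fps_comp_rinv // fps_derivX.
split=> //; have [k [_ k0 fk kf]] := comp_inverse_ex f0 f1.
suff -> : I = k by [].
by rewrite -[I]fps_compX_r -fk -fps_compA // If fps_compX.
Qed.

Section Quartic.
Variables p1 p2 p3 p4 : R.

Let calR_sqr : calR p1 p2 p3 p4 ^+ 2 =
  1 + fpsC p1 * fpsX R + fpsC p2 * fpsX R ^+ 2 + fpsC p3 * fpsX R ^+ 3
    + fpsC p4 * fpsX R ^+ 4.
Proof.
apply: (fps_sqrtP iota _).2.
by rewrite !coef_fpsD coef_fps1 !coef_fpsCM !exprS !fpsXM !mulr0 !addr0.
Qed.

(** [g'] and [R(g)] both have constant term 1, and a square root with constant term 1 is unique. *)
Lemma ode_sqrtP g : g 0%N = 0 -> g 1%N = 1 ->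
  fps_deriv g = fps_comp (calR p1 p2 p3 p4) g <->
  fps_deriv g ^+ 2 = 1 + fpsC p1 * g + fpsC p2 * g ^+ 2 + fpsC p3 * g ^+ 3
    + fpsC p4 * g ^+ 4.
Proof.
move=> g0 g1; have Rg : fps_comp (calR p1 p2 p3 p4) g ^+ 2 =
    1 + fpsC p1 * g + fpsC p2 * g ^+ 2 + fpsC p3 * g ^+ 3 + fpsC p4 * g ^+ 4.
  rewrite -fps_compXn // calR_sqr !fps_compD !fps_compCM !fps_compXn //.
  by rewrite fps_compX // fps_comp1.
split=> [->//|gE]; apply: (@fps_sqrt_uniq _ iota (fps_deriv g ^+ 2)) => //.
- by rewrite expr2 coef_fpsM0 /= g1 mulr1.
- exact: (calR_comp0 iota).
- by rewrite Rg gE.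
Qed.

Definition quartic_ode f : Prop :=
  (f * fps_deriv (fps_deriv f) - fps_deriv f ^+ 2) ^+ 2 =
  fpsC p4 * f ^+ 4 + fpsC p3 * f ^+ 3 * fps_deriv f
    + fpsC p2 * f ^+ 2 * fps_deriv f ^+ 2 + fpsC p1 * f * fps_deriv f ^+ 3
    + fps_deriv f ^+ 4.

(** From [g f' = f] one gets [f f'' - f'^2 = - f'^2 g'], so each side of [quartic_ode] is [f'^4]
    times the corresponding side for [g], and [f'^4] is regular. *)
Lemma quartic_ode_quotP f g : f 1%N = 1 -> g * fps_deriv f = f ->
  quartic_ode f <->
  fps_deriv g ^+ 2 = 1 + fpsC p1 * g + fpsC p2 * g ^+ 2 + fpsC p3 * g ^+ 3
    + fpsC p4 * g ^+ 4.
Proof.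
move=> f1 gf; rewrite /quartic_ode.
set f' := fps_deriv f in gf *; set f'' := fps_deriv f'.
have f'0 : f' 0%N = 1 by [].
have f'r : GRing.lreg (f' ^+ 4) by apply: lregX; apply: fps_lreg1.
have g'E : f * f'' - f' ^+ 2 = - (f' ^+ 2 * fps_deriv g).
  have : fps_deriv g * f' + g * f'' = f' by rewrite -fps_derivM gf.
  move=> E; rewrite -gf expr2 -{2}E; ring.
have -> : (f * f'' - f' ^+ 2) ^+ 2 = f' ^+ 4 * fps_deriv g ^+ 2.
  by rewrite g'E; ring.
have -> : fpsC p4 * f ^+ 4 + fpsC p3 * f ^+ 3 * f'
    + fpsC p2 * f ^+ 2 * f' ^+ 2 + fpsC p1 * f * f' ^+ 3 + f' ^+ 4 =
    f' ^+ 4 * (1 + fpsC p1 * g + fpsC p2 * g ^+ 2 + fpsC p3 * g ^+ 3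
    + fpsC p4 * g ^+ 4).
  by rewrite -gf; ring.
by split=> [/f'r|->].
Qed.

Lemma calB_odeP f : f 0%N = 0 -> f 1%N = 1 ->
  fps_deriv f = fps_comp (calB p1 p2 p3 p4) f <-> quartic_ode f.
Proof.
move=> f0 f1; set f' := fps_deriv f; have f'0 : f' 0%N = 1 by [].
pose g := f * rinv f'; have gf : g * f' = f.
  by rewrite /g -mulrA [rinv _ * _]mulrC fps_unit // mulr1.
have g0 : g 0%N = 0 by rewrite coef_fpsM0 f0 mul0r.
have g1 : g 1%N = 1.
  rewrite /g coef_fpsM !big_ord_recl big_ord0 f0 mul0r add0r addr0 f1 mul1r.
  exact: rinv_coef0.
rewrite (quartic_ode_quotP f1 gf) -(ode_sqrtP g0 g1).
pose mu b := fpsX R * rinv b.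
have muf (b : fps R) : b 0%N = 1 -> f' = fps_comp b f -> fps_comp (mu b) f = g.
  move=> b0 bf; rewrite fps_compM // fps_compX // /g; congr (_ * _).
  by symmetry; apply: rinvE; rewrite bf fps_comp_rinv.
have mu0 b : mu b 0%N = 0 by rewrite coef_fpsM0 mul0r.
have Dmu0 (b : fps R) : b 0%N = 1 -> fps_deriv (mu b) 0%N = 1.
  by move=> b0; rewrite deriv_fpsXM0 rinv_coef0.
have fE (b : fps R) : b 0%N = 1 -> f' = fps_comp b f ->
    fps_comp (b * fps_deriv (mu b)) f = fps_deriv g.
  by move=> b0 bf; rewrite -(muf b b0 bf) fps_deriv_comp // fps_compM // -bf.
split=> [fB|gR].
  have [b0 bE] := calBP iota p1 p2 p3 p4; rewrite -/(mu _) in bE.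
  rewrite -(fE _ b0 fB) -(muf _ b0 fB) -fps_compA //; congr (fps_comp _ f).
  by rewrite {1}bE -mulrA [rinv _ * _]mulrC (fps_unit (Dmu0 _ b0)) mulr1.
(* The only candidate with [f' = b(f)] is [f'] composed with the inverse of [f]. It satisfies the
   equation defining [calB] after composition with [f], which is injective; uniqueness of [calB]
   concludes. *)
have [k [_ k0 fk kf]] := comp_inverse_ex f0 f1.
pose b := fps_comp f' k; have bf : f' = fps_comp b f.
  by rewrite fps_compA // kf fps_compX_r.
have b0 : b 0%N = 1 by rewrite fps_comp0.
suff <- : b = calB p1 p2 p3 p4 by [].
apply: (calB_uniq iota _ (calBP iota p1 p2 p3 p4)); split=> //; rewrite -/(mu _).
have bmu : b * fps_deriv (mu b) = fps_comp (calR p1 p2 p3 p4) (mu b).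
  apply: (fps_comp_inj f0 f1); rewrite fE // gR fps_compA //.
  by rewrite muf.
by rewrite -bmu -mulrA (fps_unit (Dmu0 _ b0)) mulr1.
Qed.

End Quartic.

End RationalSeries.

(** * The derivation on Laurent series and the equation [(h')^2 = S(h)] *)

Section Laurent.
Variable R : comPzRingType.
Implicit Types (a b : laurent R) (f g : fps R).

Lemma laurent_of_fpsM f g :
  laurent_of_fps (f * g) = laurent_of_fps f * laurent_of_fps g.
Proof. by symmetry; apply: laurent_shiftM. Qed.

Fact laurent_of_fps_nmod_morphism : nmod_morphism (@laurent_of_fps R).
Proof.
split=> [|f g]; last by symmetry; apply: laurent_shiftD.
by apply/laurentP => n /=; rewrite /shift_coef; case: (n + _).
Qed.
HB.instance Definition _ := GRing.isNmodMorphism.Build (fps R) (laurent R)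
  (@laurent_of_fps R) laurent_of_fps_nmod_morphism.
Fact laurent_of_fps_monoid_morphism : monoid_morphism (@laurent_of_fps R).
Proof. by split=> // f g; apply: laurent_of_fpsM. Qed.
HB.instance Definition _ := GRing.isMonoidMorphism.Build (fps R) (laurent R)
  (@laurent_of_fps R) laurent_of_fps_monoid_morphism.

Lemma laurent_of_fps_inj : injective (@laurent_of_fps R).
Proof.
move=> f g /laurentP fg; apply/fpsP => n; have := fg n%:Z.
by rewrite !(@laurent_shiftE _ _ _ _ n) ?addr0.
Qed.

(** The quotient rule for [f / x^m]; as every Laurent series has this shape, it carries the Leibniz
    rule over from power series. *)
Lemma laurent_deriv_shift m f : laurent_deriv (laurent_shift m f) =
  laurent_shift m.+1 (fpsX R * fps_deriv f - f *+ m).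
Proof.
apply/laurentP => n.
rewrite -[LHS]/(laurent_shift m f (n + 1) *~ (n + 1)).
have [lt_n|le_n] := ltP (n + m.+1%:Z) 0.
  by rewrite !laurent_shift_lt ?mul0rz //; lia.
have [N nN] : {N : nat | n + m.+1%:Z = N%:Z}.
  by exists `|(n + m.+1%:Z)%R|%N; lia.
rewrite (laurent_shiftE _ nN) (@laurent_shiftE _ _ _ _ N); last by lia.
rewrite coef_fpsB coef_fpsMn fpsXM; have -> : n + 1 = N%:Z - m%:Z by lia.
rewrite mulrzBr -!pmulrn; congr (_ - _).
by case: N {nN}.
Qed.

Lemma laurent_derivM a b :
  laurent_deriv (a * b) = laurent_deriv a * b + a * laurent_deriv b.
Proof.
have [m [f ->]] := laurent_shift_ex a; have [k [g ->]] := laurent_shift_ex b.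
rewrite !laurent_deriv_shift [_ * _]laurent_shiftM laurent_deriv_shift.
rewrite -[laurent_shift m.+1 _ * _]/(laurent_mul _ _).
rewrite -[laurent_shift m _ * _]/(laurent_mul _ _).
rewrite !laurent_shiftM addnS addSn -[RHS]/(laurent_add _ _) laurent_shiftD.
congr laurent_shift; rewrite fps_derivM mulrnDr.
ring.
Qed.

Lemma laurent_deriv_of_fps f :
  laurent_deriv (laurent_of_fps f) = laurent_of_fps (fps_deriv f).
Proof.
rewrite laurent_deriv_shift mulr0n subr0 -(expr1 (fpsX R)) -(add0n 1%N).
by rewrite -laurent_shift_mulX.
Qed.

(** Differentiating [h f = f'] gives [h' f^2 = f f'' - f'^2]. Hence multiplication by [f^4], a unit
    among Laurent series, turns both sides into the images of the two sides of [quartic_ode]. *)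
Lemma logderiv_odeP (p1 p2 p3 p4 : R) f : f 0%N = 0 -> f 1%N = 1 ->
  laurent_deriv (logderiv f) ^+ 2 = quarticS p1 p2 p3 p4 (logderiv f) <->
  quartic_ode p1 p2 p3 p4 f.
Proof.
move=> f0 f1; have hf := logderivP f0 f1; set h := logderiv f in hf *.
set F := laurent_of_fps f in hf.
set F' := laurent_of_fps (fps_deriv f) in hf.
pose F'' := laurent_of_fps (fps_deriv (fps_deriv f)).
have Fr : GRing.lreg (F ^+ 4).
  apply: lregX => a b ab; rewrite -[a]mul1r -[b]mul1r.
  by rewrite -(laurent_of_fps_unit f0 f1) -/F ![F * _]mulrC -!mulrA ab.
have h'F : laurent_deriv h * F ^+ 2 = F * F'' - F' ^+ 2.
  have : laurent_deriv h * F + h * F' = F''.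
    have := congr1 (@laurent_deriv R) hf.
    by rewrite /F /F' laurent_derivM !laurent_deriv_of_fps.
  by move=> <-; rewrite -hf; ring.
have lE : F ^+ 4 * laurent_deriv h ^+ 2 = laurent_of_fps
    ((f * fps_deriv (fps_deriv f) - fps_deriv f ^+ 2) ^+ 2).
  rewrite rmorphXn rmorphB rmorphXn rmorphM /= -/F -/F' -/F'' -h'F; ring.
have rE : F ^+ 4 * quarticS p1 p2 p3 p4 h = laurent_of_fps
    (fpsC p4 * f ^+ 4 + fpsC p3 * f ^+ 3 * fps_deriv f
    + fpsC p2 * f ^+ 2 * fps_deriv f ^+ 2 + fpsC p1 * f * fps_deriv f ^+ 3
    + fps_deriv f ^+ 4).
  rewrite !(rmorphD, rmorphXn, rmorphM) /= -/F -/F' -hf /quarticS /laurentC; ring.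
rewrite /quartic_ode; split=> [E|E].
  by apply: laurent_of_fps_inj; rewrite -lE -rE E.
by apply: Fr; rewrite lE rE E.
Qed.

End Laurent.

(** * Passage between the quartic equation and the second-order equation [h'' = cubic(h)] *)

Section CubicOde.
Variables (R : comPzRingType) (iota : {rmorphism rat -> R}).
Implicit Types f g s t : fps R.

(* The equation says that s / f ^ m is a constant, and this constant is 0. *)
Lemma homogeneous_ode_eq0 m f s : f 0%N = 0 -> f 1%N = 1 ->
  f * fps_deriv s = fps_deriv f * s *+ m -> s m = 0 -> s = 0.
Proof.
move=> f0 f1 fs sm; apply/fpsP => n; elim/ltn_ind: n => n IHn.
have [->//|ne_nm] := eqVneq n m.
case: n IHn ne_nm => [|n] IHn ne_nm.
  have /fpsP/(_ 0%N) := fs; rewrite coef_fpsMn !coef_fpsM0 f0 mul0r /= f1 mul1r.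
  by case: m sm ne_nm {fs} => // m _ _ /esym/(mulrSn_eq0 iota).
(* As the lower coefficients of [s] vanish, degree [n.+1] reads [(n+1) s_{n+1} = m s_{n+1}]. *)
have /fpsP/(_ n.+1) := fs; rewrite coef_fpsMn !coef_fpsM.
rewrite !(@big_ord_recl _ _ _ n.+1) [in LHS]big_ord_recl.
rewrite [X in _ + (_ + X) = _]big1 => [|i _]; last first.
  by rewrite /= IHn ?mul0rn ?mulr0 //; have := ltn_ord i; rewrite /bump; lia.
rewrite [X in _ = (_ + X) *+ _]big1 => [|i _]; last first.
  by rewrite /= IHn ?mulr0 //; have := ltn_ord i; rewrite /bump; lia.
rewrite f0 mul0r add0r /= f1 !mul1r !addr0 /bump /= subSS subn0 => E.
have [lt_nm|le_mn] := ltnP n.+1 m.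
  have : s n.+1 *+ (m - n.+1).-1.+1 = 0.
    by rewrite prednK ?subn_gt0 // mulrnBr 1?ltnW // -E subrr.
  exact: mulrSn_eq0.
have : s n.+1 *+ (n.+1 - m).-1.+1 = 0.
  by rewrite prednK ?subn_gt0 ?mulrnBr // ?E ?subrr //; lia.
exact: mulrSn_eq0.
Qed.

(** For [h = f'/f] this is [h'' = 2 h^3 + q1 h^2 + q2 h + q3] multiplied by [f^2], with [2 h^3]
    absorbed on the left. *)
Definition cubic_ode (q1 q2 q3 : R) f : Prop :=
  f * fps_deriv (fps_deriv (fps_deriv f))
    - fps_deriv f * fps_deriv (fps_deriv f) *+ 3 =
  fpsC q1 * fps_deriv f ^+ 2 + fpsC q2 * f * fps_deriv f + fpsC q3 * f ^+ 2.

Lemma fps_derivXn f n : fps_deriv (f ^+ n.+1) = f ^+ n * fps_deriv f *+ n.+1.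
Proof.
elim: n => [|n IHn]; first by rewrite expr1 expr0 mul1r.
by rewrite exprS fps_derivM IHn exprS; ring.
Qed.

Lemma quartic_ode_of_cubic (q1 q2 q3 : R) f : f 0%N = 0 -> f 1%N = 1 ->
  cubic_ode q1 q2 q3 f -> exists p1 p2 p3 p4, quartic_ode p1 p2 p3 p4 f.
Proof.
move=> f0 f1; rewrite /cubic_ode => f_ode.
(* These values make [2 h'' = S'(h)] the given cubic equation. *)
pose p1 := iota (2%:R / 3%:R) * q1; pose p2 := q2; pose p3 := 2%:R * q3.
set f' := fps_deriv f in f_ode; set f'' := fps_deriv f' in f_ode.
set f''' := fps_deriv f'' in f_ode.
(* [s] is [f^4 (h'^2 - S(h))] without the term in [p4]. It has to be a constant times
   [f^4 = x^4 + ...], so the constant is its coefficient of degree 4. *)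
pose s := (f * f'' - f' ^+ 2) ^+ 2 - (fpsC p3 * f ^+ 3 * f'
    + fpsC p2 * f ^+ 2 * f' ^+ 2 + fpsC p1 * f * f' ^+ 3 + f' ^+ 4).
exists p1, p2, p3, (s 4%N).
suff : s - fpsC (s 4%N) * f ^+ 4 = 0.
  by move/eqP; rewrite subr_eq0 => /eqP sE; rewrite /quartic_ode -sE /s; ring.
apply: (@homogeneous_ode_eq0 4 f) => //; last first.
  by rewrite coef_fpsB coef_fpsCM coef_exp_diag // f1 expr1n mulr1 subrr.
have Dp : fpsC p1 *+ 3 = fpsC q1 *+ 2.
  rewrite /p1 -!raddfMn /=; congr fpsC.
  rewrite -mulrnAl -mulr_natr -(rmorph_nat iota 3) -rmorphM divfK ?pnatr_eq0 //.
  by rewrite rmorph_nat mulr_natl.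
have -> : fps_deriv (s - fpsC (s 4%N) * f ^+ 4) = fps_deriv s
    - fpsC (s 4%N) * (f ^+ 3 * f' *+ 4).
  by rewrite raddfB /= fps_derivCM fps_derivXn.
have -> : fps_deriv s = (f * f'' - f' ^+ 2) * (f * f''' - f' * f'') *+ 2
    - (fpsC p3 * (f ^+ 2 * f' ^+ 2 *+ 3 + f ^+ 3 * f'')
    + fpsC p2 * (f * f' ^+ 3 *+ 2 + f ^+ 2 * f' * f'' *+ 2)
    + fpsC p1 * (f' ^+ 4 + f * f' ^+ 2 * f'' *+ 3) + f' ^+ 3 * f'' *+ 4).
  rewrite /s -!mulrA !(raddfB, raddfD) /= !fps_derivCM !(fps_derivM, fps_derivXn).
  rewrite !(raddfB, raddfD) /= !(fps_derivM, fps_derivXn) -/f' -/f'' -/f'''; ring.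
have p3E : fpsC p3 = fpsC q3 *+ 2 by rewrite /p3 mulr_natl raddfMn.
apply/eqP; rewrite -subr_eq0; apply/eqP.
set e := f * f''' - _ in f_ode.
(* In [f s' - 4 f' s] the contributions of [s 4] cancel; what remains is a multiple of the cubic
   equation plus a term in [2 q1 - 3 p1], which is 0. *)
transitivity (f * (f * f'' - f' ^+ 2) * (e *+ 2 - (fpsC q1 * f' ^+ 2
  + fpsC q2 * f * f' + fpsC q3 * f ^+ 2) *+ 2
  + (fpsC q1 *+ 2 - fpsC p1 *+ 3) * f' ^+ 2)).
  by move: (s 4%N) => s4; rewrite /e /s p3E /p2; ring.
by rewrite f_ode Dp; ring.
Qed.

(** The terms [f'^4] cancel, and the rest is divisible by the regular series [f]. *)
Lemma quartic_ode_reduced (p1 p2 p3 p4 : R) f : f 0%N = 0 -> f 1%N = 1 ->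
  quartic_ode p1 p2 p3 p4 f ->
  f * fps_deriv (fps_deriv f) ^+ 2
    - fps_deriv f ^+ 2 * fps_deriv (fps_deriv f) *+ 2 =
  fpsC p4 * f ^+ 3 + fpsC p3 * f ^+ 2 * fps_deriv f
    + fpsC p2 * f * fps_deriv f ^+ 2 + fpsC p1 * fps_deriv f ^+ 3.
Proof.
move=> f0 f1; rewrite /quartic_ode => E.
apply: (fps_lregX f0 f1); apply: (addIr (fps_deriv f ^+ 4)).
by transitivity ((f * fps_deriv (fps_deriv f) - fps_deriv f ^+ 2) ^+ 2);
  [ring | rewrite E; ring].
Qed.

(** The constant terms of the reduced equation are [- 2 f''(0) = p1]. *)
Lemma quartic_ode_p1 (p1 p2 p3 p4 : R) f : f 0%N = 0 -> f 1%N = 1 ->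
  quartic_ode p1 p2 p3 p4 f -> p1 = - f 2%N *+ 4.
Proof.
move=> f0 f1 /(quartic_ode_reduced f0 f1)/fpsP/(_ 0%N).
rewrite coef_fpsB coef_fpsMn !coef_fpsD !exprS !expr0 !coef_fpsM0 /= f0 f1.
rewrite !(mulr0n, mul0r, mulr0, mul1r, mulr1, add0r, addr0) => <-.
by ring.
Qed.

(** This is [2 h'' = S'(h)] times [f^2]. It comes from differentiating [h'^2 = S(h)] and cancelling
    [h'], which is possible since [f^2 h' = f f'' - f'^2] has constant term -1. *)
Lemma cubic_ode_of_quartic (p1 p2 p3 p4 : R) f : f 0%N = 0 -> f 1%N = 1 ->
  quartic_ode p1 p2 p3 p4 f ->
  (f * fps_deriv (fps_deriv (fps_deriv f))
    - fps_deriv f * fps_deriv (fps_deriv f) *+ 3) *+ 2 =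
  fpsC p1 * fps_deriv f ^+ 2 *+ 3 + fpsC p2 * f * fps_deriv f *+ 2
    + fpsC p3 * f ^+ 2.
Proof.
move=> f0 f1; rewrite /quartic_ode.
set f' := fps_deriv f; set f'' := fps_deriv f'; set f''' := fps_deriv f''.
move=> E.
have DE : (f * f'' - f' ^+ 2) * (f * f''' - f' * f'') *+ 2 =
    fpsC p4 * (f ^+ 3 * f' *+ 4)
    + fpsC p3 * (f ^+ 2 * f' ^+ 2 *+ 3 + f ^+ 3 * f'')
    + fpsC p2 * (f * f' ^+ 3 *+ 2 + f ^+ 2 * f' * f'' *+ 2)
    + fpsC p1 * (f' ^+ 4 + f * f' ^+ 2 * f'' *+ 3) + f' ^+ 3 * f'' *+ 4.
  transitivity (fps_deriv ((f * f'' - f' ^+ 2) ^+ 2)).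
    rewrite fps_derivXn raddfB /= fps_derivXn fps_derivM -/f' -/f'' -/f'''; ring.
  rewrite E -!mulrA !raddfD /= !fps_derivCM !(fps_derivM, fps_derivXn).
  rewrite -/f' -/f''; ring.
have Gr : GRing.lreg (f' ^+ 2 - f * f'').
  apply: fps_lreg1.
  by rewrite coef_fpsB expr2 !coef_fpsM0 f0 mul0r subr0 /= f1 mulr1.
apply: (fps_lregX f0 f1); apply: Gr; apply/eqP; rewrite -subr_eq0; apply/eqP.
set G := f * f'' - f' ^+ 2 in E DE.
move: DE E; set DS := (X in _ = X -> _); set S := (X in _ -> _ = X -> _).
move=> DE E.
(* The combination [f DS - 4 f' S] eliminates [p4]. *)
transitivity (f' * G ^+ 2 *+ 4 - f * (G * (f * f''' - f' * f'') *+ 2)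
  + f * DS - f' * S *+ 4).
  by rewrite /G /DS /S; ring.
by rewrite DE E; ring.
Qed.

End CubicOde.

(** * Series in two variables: [g(u)], [g(v)], [f(u + v)] and the partial derivatives *)

Section TwoVariables.
Variable R : comPzRingType.
Implicit Types (f g : fps R) (F G : fps (fps R)).

(** The series [g(v)]; since [v] is the outer variable, [g(u)] is simply [fpsC g]. *)
Definition at_v g : fps (fps R) := Fps (fun j => fpsC (g j)).

Fact at_v_nmod_morphism : nmod_morphism at_v.
Proof.
by split=> [|f g]; apply/fpsP => j; rewrite /= ?rmorph0 ?rmorphD.
Qed.
HB.instance Definition _ :=
  GRing.isNmodMorphism.Build (fps R) (fps (fps R)) at_v at_v_nmod_morphism.
Fact at_v_monoid_morphism : monoid_morphism at_v.
Proof.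
split=> [|f g]; apply/fpsP => j; first by case: j => [|j] //=; apply: rmorph0.
by rewrite /= rmorph_sum; apply: eq_bigr => i _; rewrite rmorphM.
Qed.
HB.instance Definition _ := GRing.isMonoidMorphism.Build (fps R) (fps (fps R))
  at_v at_v_monoid_morphism.

Lemma at_vC (c : R) : at_v (fpsC c) = fpsC (fpsC c).
Proof. by apply/fpsP => -[|j] //=; rewrite rmorph0. Qed.

Lemma fps_comp2_varu f : fps_comp2 f (varu R) = fpsC f.
Proof.
have X n i : (fpsX R ^+ n) i = (i == n)%:R.
  elim: n i => [|n IHn] i; first by rewrite expr0 coef_fps1.
  by rewrite exprS fpsXM; case: i.
apply/fpsP => j; apply/fpsP => i; rewrite /= /varu.
under eq_bigr => k _ do rewrite -rmorphXn /=.
case: j => [|j]; last by rewrite big1 // => k _; rewrite mulr0.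
rewrite addn0 big_ord_recr /= X eqxx mulr1 big1 ?add0r // => k _.
by rewrite X gtn_eqF ?mulr0.
Qed.

Lemma fps_comp2_varv f : fps_comp2 f (varv R) = at_v f.
Proof.
have X n j : (varv R ^+ n) j = (j == n)%:R.
  elim: n j => [|n IHn] j; first by rewrite expr0 coef_fps1.
  by rewrite exprS fpsXM; case: j.
apply/fpsP => j; apply/fpsP => i; rewrite /=.
under eq_bigr => k _ do rewrite X.
have lt_j : (j < (i + j).+1)%N by lia.
rewrite (bigD1 (Ordinal lt_j)) //= eqxx big1 => [|k].
  by rewrite addr0; case: i {lt_j} => [|i]; rewrite ?mulr1 ?mulr0.
rewrite -val_eqE /= eq_sym => /negPf ->; by rewrite mulr0.
Qed.

Lemma coef_binomial n j i :
  ((varu R + varv R) ^+ n) j i = (n == i + j)%N%:R *+ 'C(n, j).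
Proof.
elim: n j i => [|n IHn] j i.
  rewrite expr0 coef_fps1; case: j => [|j]; last by rewrite addnS mul0rn.
  by rewrite addn0 bin0 mulr1n coef_fps1 eq_sym.
rewrite exprS mulrDl !coef_fpsD coef_fpsCM fpsXM /varv fpsXM.
case: j => [|j]; case: i => [|i]; rewrite ?IHn ?addr0 ?addn0 ?add0r ?bin0 //.
- rewrite !add0n eqSS.
  by have [->|_] := eqVneq n j; rewrite ?binn ?mul0rn.
- by rewrite !(addSn, addnS) !eqSS binS mulrnDr.
Qed.

Lemma coef_fps_comp2_add f j i :
  fps_comp2 f (varu R + varv R) j i = f (i + j)%N *+ 'C(i + j, j).
Proof.
rewrite /= big_ord_recr /= coef_binomial eqxx mulrnAr mulr1 big1 ?add0r // => k _.
by rewrite coef_binomial ltn_eqF ?mul0rn ?mulr0.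
Qed.

(** The inner variable is [u], so [d/du] acts on each coefficient, while [fps_deriv] on
    [fps (fps R)] is [d/dv]. *)
Definition fps_derivu F : fps (fps R) := Fps (fun j => fps_deriv (F j)).

Fact fps_derivu_nmod_morphism : nmod_morphism fps_derivu.
Proof. by split=> [|F G]; apply/fpsP => j; rewrite /= ?raddf0 ?raddfD. Qed.
HB.instance Definition _ := GRing.isNmodMorphism.Build (fps (fps R))
  (fps (fps R)) fps_derivu fps_derivu_nmod_morphism.

Lemma fps_derivuB F G : fps_derivu (F - G) = fps_derivu F - fps_derivu G.
Proof. exact: raddfB. Qed.

Lemma fps_derivuMn F n : fps_derivu (F *+ n) = fps_derivu F *+ n.
Proof. exact: raddfMn. Qed.

Lemma fps_derivuM F G : fps_derivu (F * G) = fps_derivu F * G + F * fps_derivu G.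
Proof.
apply/fpsP => j; rewrite coef_fpsD !coef_fpsM -big_split /= raddf_sum /=.
by apply: eq_bigr => i _; rewrite fps_derivM.
Qed.

Lemma fps_derivuC f : fps_derivu (fpsC f) = fpsC (fps_deriv f).
Proof. by apply/fpsP => -[|j] //=; rewrite raddf0. Qed.

Lemma fps_derivu_at_v f : fps_derivu (at_v f) = 0.
Proof. by apply/fpsP => j; rewrite /= fps_derivC. Qed.

Lemma fps_deriv_at_v f : fps_deriv (at_v f) = at_v (fps_deriv f).
Proof. by apply/fpsP => j; rewrite /= rmorphMn. Qed.

(** At [u^i v^j] this is [(i+1) C(i+j+1, j) = (j+1) C(i+j+1, j+1)]. *)
Lemma fps_derivu_comp2_add f : fps_derivu (fps_comp2 f (varu R + varv R)) =
  fps_deriv (fps_comp2 f (varu R + varv R)).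
Proof.
apply/fpsP => j; apply/fpsP => i.
rewrite [LHS]coef_fps_deriv coef_fps_deriv coef_fpsMn !coef_fps_comp2_add.
rewrite -!mulrnA addSn addnS; congr (_ *+ _).
have -> : i.+1 = ((i + j).+1 - j)%N by lia.
by rewrite mulnC -mul_bin_left mulnC.
Qed.

End TwoVariables.

(** * The addition theorem and the differential equations for [f] *)

Section AdditionTheorem.
Variables (R : comPzRingType) (iota : {rmorphism rat -> R}).
Implicit Types (f g : fps R) (F G : fps (fps R)).

Local Notation dif F := (fps_deriv F - fps_derivu F).

(* The equation says that E / D depends on u + v only. *)
Lemma translation_ode_eq0 (D E X : fps (fps R)) : GRing.lreg (D 0%N) ->
  D * dif E = E * X -> E 0%N = 0 -> E = 0.
Proof.
move=> D0 DE E0; apply/fpsP => n; elim/ltn_ind: n => -[//|n] IHn.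
(* As the coefficients of [E] up to [v^n] vanish, the equation at [v^n] reads
   [(n+1) D_0 E_{n+1} = 0], with [D_0] regular. *)
have /fpsP/(_ n) := DE; rewrite !coef_fpsM big_ord_recl.
rewrite big1 ?addr0 => [|i _]; last first.
  rewrite coef_fpsB /= !IHn ?mul0rn ?raddf0 ?addr0 ?mulr0 // /bump;
    by have := ltn_ord i; lia.
rewrite big1 => [|i _]; last by rewrite IHn ?mul0r.
rewrite subn0 coef_fpsB /= (IHn n) // raddf0 subr0 -[RHS](mulr0 (D 0%N)) => /D0.
exact: (fps_mulrSn_eq0 iota).
Qed.

Lemma addition_theorem_of_quartic (p1 p2 p3 p4 : R) f :
  f 0%N = 0 -> f 1%N = 1 -> quartic_ode p1 p2 p3 p4 f -> has_addition_theorem f.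
Proof.
move=> f0 f1 f_ode; pose half := iota 2%:R^-1; pose f' := fps_deriv f.
pose f'' := fps_deriv f'; pose f''' := fps_deriv f''.
have hf'0 : f' 0%N = 1 by [].
pose xi := f' ^+ 2 - fpsC half * (f * f'') - fpsC (f 2%N) * (f * f').
have xi0 : xi 0%N = 1.
  rewrite !coef_fpsB !coef_fpsCM expr2 !coef_fpsM0 f0 hf'0.
  by rewrite !mul0r !mulr0 mulr1 !subr0.
exists xi, f'; split=> //.
rewrite /= !fps_comp2_varu !fps_comp2_varv.
set F := fps_comp2 _ _.
set N := _ - _; set D := _ - _.
(* At [v = 0] the denominator is [f(u)], which is regular; hence so is [D], as [is_quotient]
   demands. *)
have D0 : D 0%N = f.
  rewrite /D coef_fpsB coef_fpsCM coef_fpsM0 /= f0 f1 mulr1n.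
  by rewrite rmorph0 rmorph1 mulr1 mul0r subr0.
have D0r : GRing.lreg (D 0%N) by rewrite D0; apply: fps_lregX.
split; first exact: fps_lreg.
have half2 : fpsC half *+ 2 = 1.
  by rewrite -raddfMn /= -mulr_natr /half (iotaK iota 1) rmorph1.
(* From here [a], [a1], [a2], [a3] are [f] and its derivatives at [u], and [b], [b1], [b2], [b3]
   those at [v]; the claims become polynomial identities. *)
pose a := fpsC f; pose a1 := fpsC f'; pose a2 := fpsC f''; pose a3 := fpsC f'''.
pose b := at_v f; pose b1 := at_v f'; pose b2 := at_v f''; pose b3 := at_v f'''.
pose c := fpsC (fpsC (f 2%N)).
have fp1 := quartic_ode_p1 f0 f1 f_ode.
have cubic := cubic_ode_of_quartic f0 f1 f_ode.
have red := quartic_ode_reduced f0 f1 f_ode.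
rewrite -/f' -/f'' -/f''' in cubic red.
pose P2 := fpsC (fpsC p2); pose P3 := fpsC (fpsC p3); pose P4 := fpsC (fpsC p4).
have P1E : fpsC (fpsC p1) = - c *+ 4 by rewrite fp1 !raddfMn !raddfN.
have cubic_u : (a * a3 - a1 * a2 *+ 3) *+ 2 =
    - c *+ 4 * a1 ^+ 2 *+ 3 + P2 * a * a1 *+ 2 + P3 * a ^+ 2.
  have := congr1 (@fpsC (fps R)) cubic; rewrite -P1E.
  by rewrite !(rmorphMn, rmorphB, rmorphD, rmorphM, rmorphXn).
have cubic_v : (b * b3 - b1 * b2 *+ 3) *+ 2 =
    - c *+ 4 * b1 ^+ 2 *+ 3 + P2 * b * b1 *+ 2 + P3 * b ^+ 2.
  have := congr1 (@at_v R) cubic; rewrite -P1E.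
  by rewrite !(rmorphMn, rmorphB, rmorphD, rmorphM, rmorphXn) /= !at_vC.
have red_u : a * a2 ^+ 2 - a1 ^+ 2 * a2 *+ 2 = P4 * a ^+ 3 + P3 * a ^+ 2 * a1
    + P2 * a * a1 ^+ 2 + - c *+ 4 * a1 ^+ 3.
  have := congr1 (@fpsC (fps R)) red; rewrite -P1E.
  by rewrite !(rmorphMn, rmorphB, rmorphD, rmorphM, rmorphXn).
have red_v : b * b2 ^+ 2 - b1 ^+ 2 * b2 *+ 2 = P4 * b ^+ 3 + P3 * b ^+ 2 * b1
    + P2 * b * b1 ^+ 2 + - c *+ 4 * b1 ^+ 3.
  have := congr1 (@at_v R) red; rewrite -P1E.
  by rewrite !(rmorphMn, rmorphB, rmorphD, rmorphM, rmorphXn) /= !at_vC.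
have DE : D = a * b1 - b * a1 by [].
have dD : dif D = a * b2 + b * a2 - a1 * b1 *+ 2.
  rewrite DE !(fps_derivB, fps_derivuB, fps_derivM, fps_derivuM) !fps_derivuC.
  rewrite !fps_derivu_at_v !fps_deriv_at_v !fps_derivC; ring.
(* Doubling [N] clears the factor [half]. *)
have N2 : N *+ 2 = a ^+ 2 * (b1 ^+ 2 *+ 2 - b * b2 - c * (b * b1) *+ 2)
    - b ^+ 2 * (a1 ^+ 2 *+ 2 - a * a2 - c * (a * a1) *+ 2).
  rewrite /N /xi !(rmorphB, rmorphM, rmorphXn) /= !at_vC.
  have := congr1 (@fpsC (fps R)) half2; rewrite rmorphMn rmorph1 => H.
  rewrite -/a -/b -/a1 -/b1 -/a2 -/b2 -/c.
  transitivity (a ^+ 2 * (b1 ^+ 2 *+ 2 - (fpsC (fpsC half) *+ 2) * (b * b2)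
      - c * (b * b1) *+ 2)
    - b ^+ 2 * (a1 ^+ 2 *+ 2 - (fpsC (fpsC half) *+ 2) * (a * a2)
      - c * (a * a1) *+ 2)); first by ring.
  by rewrite H; ring.
have dN2 : dif (N *+ 2) =
    a ^+ 2 * (b1 * b2 *+ 3 - b * b3 - c * (b1 ^+ 2 + b * b2) *+ 2)
    - b * b1 * (a1 ^+ 2 *+ 2 - a * a2 - c * (a * a1) *+ 2) *+ 2
    - a * a1 * (b1 ^+ 2 *+ 2 - b * b2 - c * (b * b1) *+ 2) *+ 2
    + b ^+ 2 * (a1 * a2 *+ 3 - a * a3 - c * (a1 ^+ 2 + a * a2) *+ 2).
  rewrite N2 !expr2 !(fps_derivB, fps_derivuB, fps_derivMn, fps_derivuMn,
    fps_derivM, fps_derivuM).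
  rewrite !fps_derivuC !fps_derivu_at_v !fps_deriv_at_v !fps_derivC.
  rewrite -/f' -/f'' -/f''' -/a -/a1 -/a2 -/a3 -/b -/b1 -/b2 -/b3.
  rewrite raddf0; ring.
(* [fps R] is again a Q-algebra, through [fpsC \o iota], so two-variable series have no
   2-torsion. *)
have mul2_eq0 (x : fps (fps R)) : x *+ 2 = 0 -> x = 0.
  exact: (@fps_mulrSn_eq0 (fps R) (@fpsC R \o iota : {rmorphism rat -> fps R}) 1).
have dN : dif (N *+ 2) * D = (N *+ 2) * dif D.
  apply/eqP; rewrite -subr_eq0; apply/eqP/mul2_eq0.
  move/eqP: cubic_u; rewrite -subr_eq0 => /eqP; set eq_u := _ - _ => cubic_u.
  move/eqP: cubic_v; rewrite -subr_eq0 => /eqP; set eq_v := _ - _ => cubic_v.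
  move/eqP: red_u; rewrite -subr_eq0 => /eqP; set eq_u' := _ - _ => red_u.
  move/eqP: red_v; rewrite -subr_eq0 => /eqP; set eq_v' := _ - _ => red_v.
  (* The weights [a^3] and [b^3] eliminate [P4]; the multiples of the two cubic equations then
     remove [P2] and [P3]. *)
  transitivity ((a ^+ 3 * eq_v' - b ^+ 3 * eq_u') *+ 2
      - b ^+ 2 * D * eq_u - a ^+ 2 * D * eq_v).
    rewrite dN2 N2 dD DE /eq_u /eq_v /eq_u' /eq_v'; ring.
  by rewrite cubic_u cubic_v red_u red_v !mulr0 subrr mul0rn !subr0.
apply/eqP; rewrite -subr_eq0; apply/eqP/mul2_eq0.
have FD2 : (F * D - N) *+ 2 = (F * D) *+ 2 - N *+ 2 by rewrite mulrnBl.
(* Take [E = 2 (F D - N)]. Since [dif] kills [F], [D dif E = E dif D]; and [E] vanishes at [v = 0],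
   where [F D] and [N] are both [f^2]. *)
rewrite FD2; apply: (@translation_ode_eq0 D _ (dif D)) => //; last first.
  rewrite -FD2 coef_fpsMn coef_fpsB coef_fpsM0 D0.
  have -> : F 0%N = f.
    by apply/fpsP => i; rewrite coef_fps_comp2_add addn0 bin0.
  rewrite /N coef_fpsB !expr2 !coef_fpsM0.
  rewrite -[at_v xi 0%N]/(fpsC (xi 0%N)) -[at_v f 0%N]/(fpsC (f 0%N)) xi0 f0.
  by rewrite rmorph0 rmorph1 !mul0r subr0 mulr1 subrr mul0rn.
have -> : dif ((F * D) *+ 2 - N *+ 2) = F * dif D *+ 2 - dif (N *+ 2).
  rewrite fps_derivB fps_derivuB !fps_derivMn !fps_derivuMn.
  rewrite fps_derivM fps_derivuM.
  have -> : fps_deriv F = fps_derivu F by rewrite fps_derivu_comp2_add.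
  by ring.
by rewrite mulrBr [D * dif (N *+ 2)]mulrC dN; ring.
Qed.

Lemma cubic_of_addition_theorem f : f 0%N = 0 -> f 1%N = 1 ->
  has_addition_theorem f -> exists q1 q2 q3, cubic_ode q1 q2 q3 f.
Proof.
move=> f0 f1 [xi1 [xi2 [xi10 xi20 [_]]]].
rewrite /= !fps_comp2_varu !fps_comp2_varv -!rmorphXn /=.
set F := fps_comp2 _ _; set D := _ - _; set N := _ - _ => FD.
have F0 : F 0%N = f by apply/fpsP => i; rewrite coef_fps_comp2_add addn0 bin0.
(* This recursion makes [F j] the Taylor coefficient [f^(j) / j!]. *)
have FS j : F j.+1 *+ j.+1 = fps_deriv (F j).
  have /fpsP/(_ j) := fps_derivu_comp2_add f.
  by rewrite coef_fps_deriv => <-.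
have DjE j : D j = fpsC (xi2 j) * f - fpsC (f j) * xi2.
  rewrite /D coef_fpsB coef_fpsCM [_ * fpsC xi2]mulrC coef_fpsCM.
  by rewrite mulrC [xi2 * _]mulrC.
have NjE j : N j = fpsC (xi1 j) * f ^+ 2 - fpsC ((f ^+ 2) j) * xi1.
  rewrite /N coef_fpsB coef_fpsCM [_ * fpsC xi1]mulrC coef_fpsCM.
  by rewrite mulrC [xi1 * _]mulrC.
move: F D N FD F0 FS DjE NjE => F D N FD F0 FS DjE NjE.
have fr : GRing.lreg f by apply: fps_lregX.
have D0 : D 0%N = f by rewrite DjE xi20 f0 rmorph0 rmorph1 mul0r mul1r subr0.
have coefFD n : \sum_(i < n.+1) F i * D (n - i)%N = N n by rewrite -FD.
pose f2 := f 2%N; pose f3 := f 3%N.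
have f_2 : (f ^+ 2) 2%N = 1 by rewrite coef_exp_diag // f1 expr1n.
have f_1 : (f ^+ 2) 1%N = 0 by rewrite coef_exp_lt.
have f_3 : (f ^+ 2) 3%N = f2 *+ 2.
  rewrite expr2 coef_fpsM !big_ord_recl big_ord0 /= /bump /= f0 f1.
  by rewrite mul0r mulr0 mul1r mulr1 add0r !addr0.
set f' := fps_deriv f; set f'' := fps_deriv f'; set f''' := fps_deriv f''.
have F1 : F 1%N = f' by rewrite -[F 1%N]mulr1n FS F0.
have F2 : F 2%N *+ 2 = f'' by rewrite FS F1.
have F3 : F 3%N *+ 6 = f''' by rewrite -[6%N]/(3 * 2)%N mulrnA FS -raddfMn F2.
pose b1 := fpsC (xi2 1%N); pose b2 := fpsC (xi2 2%N); pose b3 := fpsC (xi2 3%N).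
pose a1 := fpsC (xi1 1%N); pose a2 := fpsC (xi1 2%N); pose a3 := fpsC (xi1 3%N).
have D1 : D 1%N = b1 * f - xi2 by rewrite DjE f1 rmorph1 mul1r.
have D2 : D 2%N = b2 * f - fpsC f2 * xi2 by rewrite DjE.
have D3 : D 3%N = b3 * f - fpsC f3 * xi2 by rewrite DjE.
have N1 : N 1%N = a1 * f ^+ 2 by rewrite NjE f_1 rmorph0 mul0r subr0.
have N2 : N 2%N = a2 * f ^+ 2 - xi1 by rewrite NjE f_2 rmorph1 mul1r.
have N3 : N 3%N = a3 * f ^+ 2 - fpsC f2 * xi1 *+ 2.
  by rewrite NjE f_3 rmorphMn mulrnAl.
(* The coefficient of [v] in [F D = N], divided by the regular series [f]. *)
have xi2E : xi2 = f' + (b1 - a1) * f.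
  apply: fr; have := coefFD 1%N.
  rewrite !big_ord_recl big_ord0 /= /bump /= subn0 subnn F0 F1 D0 D1 N1 addr0.
  move=> E; apply: (addIr (a1 * f ^+ 2)); rewrite -{1}E; ring.
(* In degree 1 of [xi2E] the coefficient [xi2 1] occurs on both sides and cancels. *)
have a1E : a1 = fpsC f2 *+ 2.
  have /fpsP/(_ 1%N) := xi2E; rewrite coef_fpsD -raddfB coef_fpsCM f1 mulr1 /=.
  move=> E; rewrite /a1 -raddfMn /=; congr fpsC.
  have := E; rewrite -/f2 addrCA -[LHS]addr0 => /addrI/eqP.
  by rewrite eq_sym subr_eq0 => /eqP.
(* The coefficient of [v^2], doubled because [F 2] is [f''/2]. *)
have xi1E : xi1 *+ 2 = (a2 * f ^+ 2 - f' * (b1 * f - xi2)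
    - f * (b2 * f - fpsC f2 * xi2)) *+ 2 - f'' * f.
  have := coefFD 2%N.
  rewrite !big_ord_recl big_ord0 /= /bump /= subn0 subnn F0 F1 D0 D1 D2 N2 addr0.
  rewrite -F2 => E; have -> : xi1 = a2 * f ^+ 2 - (a2 * f ^+ 2 - xi1) by ring.
  by rewrite -E; ring.
(* The coefficient of [v^3], times 6. *)
have E3 : f''' * f + f'' * (b1 * f - xi2) *+ 3
    + f' * (b2 * f - fpsC f2 * xi2) *+ 6 + f * (b3 * f - fpsC f3 * xi2) *+ 6
    = a3 * f ^+ 2 *+ 6 - fpsC f2 * (xi1 *+ 2) *+ 6.
  have := coefFD 3%N.
  rewrite !big_ord_recl big_ord0 /= /bump /= subn0 subnn F0 F1 D0 D1 D2 D3 N3.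
  rewrite addr0.
  rewrite -F3 -F2 => E.
  have -> : a3 * f ^+ 2 *+ 6 - fpsC f2 * (xi1 *+ 2) *+ 6 =
    (a3 * f ^+ 2 - fpsC f2 * xi1 *+ 2) *+ 6 by ring.
  by rewrite -E; ring.
(* Substituting [xi2] gives [D 2 = B f - f2 f'] and [D 3 = C f - f3 f']. In [E3] the terms in
   [f f''] then cancel, and the witnesses are the remaining coefficients of [f'^2], [f f'] and
   [f^2]. *)
pose B := xi2 2%N - f2 * (xi2 1%N - f2 *+ 2).
pose C := xi2 3%N - f3 * (xi2 1%N - f2 *+ 2).
exists (- f2 *+ 6), ((f3 - B + f2 ^+ 2 *+ 2) *+ 6),
  ((xi1 3%N - C + f2 * (B - xi1 2%N) *+ 2) *+ 6).
rewrite /cubic_ode -/f' -/f'' -/f''' /B /C.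
rewrite !(rmorphMn, rmorphB, rmorphN, rmorphD, rmorphM, rmorphXn) /=.
rewrite -/b1 -/b2 -/b3 -/a2 -/a3.
rewrite xi1E xi2E a1E in E3.
apply/eqP; rewrite -subr_eq0; apply/eqP.
move/eqP: E3; rewrite -subr_eq0 => /eqP <-.
ring.
Qed.

End AdditionTheorem.

Theorem corollary1p2 (R : comPzRingType) (iota : {rmorphism rat -> R})
    (f : fps R) (hf0 : f 0%N = 0) (hf1 : fps_deriv f 0%N = 1) :
  let inversion (p1 p2 p3 p4 : R) :=
    is_comp_inverse f (fps_int iota (rinv (calB p1 p2 p3 p4))) in
  let cond0 := has_addition_theorem f in
  let condi := exists p1 p2 p3 p4 : R, inversion p1 p2 p3 p4 in
  let condii := exists p1 p2 p3 p4 : R,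
    laurent_deriv (logderiv f) ^+ 2 = quarticS p1 p2 p3 p4 (logderiv f) in
  [/\ forall p1 p2 p3 p4 : R,
        inversion p1 p2 p3 p4 <-> fps_deriv f = fps_comp (calB p1 p2 p3 p4) f,
      cond0 <-> condi
    & condi <-> condii].

Proof.
have f1 : f 1%N = 1 by exact: hf1.
(* Conditions (i) and (ii) are both matched to [quartic_ode] with the same parameters; starting from
   (0), the parameters come from the cubic equation. *)
have inversionP p1 p2 p3 p4 :
    is_comp_inverse f (fps_int iota (rinv (calB p1 p2 p3 p4))) <->
    quartic_ode p1 p2 p3 p4 f.
  rewrite -(calB_odeP iota) //; apply: comp_inverse_intP => //.
  by case: (calBP iota p1 p2 p3 p4).
move=> inversion cond0 condi condii; split.
- by move=> p1 p2 p3 p4; rewrite (calB_odeP iota) //; apply: inversionP.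
- split=> [|[p1 [p2 [p3 [p4 /inversionP]]]]]; last first.
    exact: (addition_theorem_of_quartic iota).
  case/(cubic_of_addition_theorem hf0 f1) => q1 [q2 [q3]].
  case/(quartic_ode_of_cubic iota hf0 f1) => p1 [p2 [p3 [p4 ode]]].
  by exists p1, p2, p3, p4; apply/inversionP.
- split=> -[p1 [p2 [p3 [p4 ode]]]]; exists p1, p2, p3, p4.
    by apply/logderiv_odeP => //; apply/inversionP.
  by apply/inversionP/logderiv_odeP.
Qed.
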